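(* Let $\mathbb{F}$ be a field, $T\subseteq\mathbb{F}$ a finite set, $e\ge 0$ an integer, $\mathbf s\colon T\to\mathbb{Z}_{\ge0}$ a function, and $h\colon T\to\mathbb{F}[z]$ with $h(a)=\sum_{i=0}^{\mathbf s(a)-1}h_a^{(i)}z^i$ for each $a\in T$. Let $N=\sum_{a\in T}\mathbf s(a)$. There is an algorithm running in time $N^{O(1)}$ which, on input $(T,e,\mathbf s,h)$, behaves as follows: if $R\in\mathbb{F}_{\le e}[x]$ satisfies $\Delta^{(\mathbf s)}_{\mathrm{mult}}\big(h,\mathrm{Enc}^{(\mathbf s)}(R)\big)<\frac12(N-e)$, then the algorithm outputs $R$; and if no such $R$ exists, the algorithm outputs $\bot$.
   Context: For $R\in\mathbb{F}[x]$, $\mathrm{Enc}^{(\mathbf s)}(R)\colon T\to\mathbb{F}[z]$ is $a\mapsto R(a+z)\bmod z^{\mathbf s(a)}$. For a univariate polynomial $Q$ and integer $t\ge0$, $d^{(t)}_{\min}(Q)$ is the minimum of $t$ and the lowest degree of a monomial with nonzero coefficient in $Q$ ($d^{(t)}_{\min}(0)=t$). Then $\Delta^{(\mathbf s)}_{\mathrm{mult}}(h,g)=\sum_{a\in T}\big(\mathbf s(a)-d^{(\mathbf s(a))}_{\min}(h(a)-g(a))\big)$.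
   Formalization: The running time is (N+|T|+2)^{O(1)} in a unit-cost algebraic RAM instead of N^{O(1)}, since points with s(a)=0 occupy input but do not count in N; if s(a)≥1 on T this is polynomial in N. *)

(* Defs.v *)
From mathcomp Require Import all_boot all_order all_algebra.
Set Implicit Arguments. Unset Strict Implicit. Unset Printing Implicit Defensive.
Import GRing.Theory.
Local Open Scope ring_scope.

Definition Enc (F : fieldType) (s : F -> nat) (R : {poly F}) (a : F) : {poly F} :=
  (R \Po ('X + a%:P)) %% 'X^(s a).

Definition dmin (F : fieldType) (t : nat) (Q : {poly F}) : nat :=
  \big[minn/t]_(i < size Q | Q`_i != 0) (i : nat).

Definition Delta_mult (F : fieldType) (T : seq F) (s : F -> nat)
  (h g : F -> {poly F}) : nat :=
  (\sum_(a <- T) (s a - dmin (s a) (h a - g a)))%N.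

(* A uniform algebraic RAM model over an arbitrary field F             *)
(* (unit cost per instruction; field operations + - * ^-1 and equality *)
(* tests on field registers; natural-number registers with +, truncated *)
(* -, zero test and indirect addressing; constants only 0,1 in F).    *)

Inductive instr :=
| NConst (i k : nat)
| NAdd (i j k : nat)
| NSub (i j k : nat)        (* N[i] := N[j] - N[k] (truncated) *)
| NLoad (i j : nat)
| NStore (i j : nat)
| FZero (i : nat)
| FOne (i : nat)
| FAdd (i j k : nat)
| FOpp (i j : nat)
| FMul (i j k : nat)
| FInv (i j : nat)          (* Fr[i] := Fr[j]^-1  (0^-1 = 0) *)
| FLoad (i j : nat)
| FStore (i j : nat)
| JmpNZ (i l : nat)
| JmpFEq (i j l : nat)
| Halt.

Record config (F : Type) := Config {
  pc : nat; nreg : nat -> nat; freg : nat -> F }.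

Definition upd (A : Type) (f : nat -> A) (i : nat) (x : A) : nat -> A :=
  fun j => if j == i then x else f j.

Definition fetch (P : seq instr) (n : nat) : instr := nth Halt P n.

Definition halted (F : Type) (P : seq instr) (c : config F) : bool :=
  if fetch P (pc c) is Halt then true else false.

Definition step (F : fieldType) (P : seq instr) (c : config F) : config F :=
  let: Config p N R := c in
  match fetch P p with
  | NConst i k => Config p.+1 (upd N i k) R
  | NAdd i j k => Config p.+1 (upd N i (N j + N k)%N) R
  | NSub i j k => Config p.+1 (upd N i (N j - N k)%N) R
  | NLoad i j => Config p.+1 (upd N i (N (N j))) R
  | NStore i j => Config p.+1 (upd N (N i) (N j)) R
  | FZero i => Config p.+1 N (upd R i 0)
  | FOne i => Config p.+1 N (upd R i 1)
  | FAdd i j k => Config p.+1 N (upd R i (R j + R k))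
  | FOpp i j => Config p.+1 N (upd R i (- R j))
  | FMul i j k => Config p.+1 N (upd R i (R j * R k))
  | FInv i j => Config p.+1 N (upd R i (R j)^-1)
  | FLoad i j => Config p.+1 N (upd R i (R (N j)))
  | FStore i j => Config p.+1 N (upd R (N i) (R j))
  | JmpNZ i l => Config (if N i != 0%N then l else p.+1) N R
  | JmpFEq i j l => Config (if R i == R j then l else p.+1) N R
  | Halt => c
  end.

Fixpoint run (F : fieldType) (P : seq instr) (k : nat) (c : config F) : config F :=
  match k with
  | 0 => c
  | k'.+1 => if halted P c then c else run P k' (step P c)
  end.

(* Input encoding of (T, e, s, h):
   nat registers:   N[0] = |T|, N[1] = e, N[2+k] = s(T_k), others 0;
   field registers: Fr[0..|T|-1] = T, followed by the coefficients
   h(T_k)^(0), ..., h(T_k)^(s(T_k)-1) for k = 0, 1, ..., others 0. *)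
Definition init (F : fieldType) (T : seq F) (e : nat) (s : F -> nat)
  (h : F -> {poly F}) : config F :=
  Config 0
    (fun k => nth 0%N (size T :: e :: map s T) k)
    (fun k => nth 0 (T ++ flatten [seq [seq (h a)`_i | i <- iota 0 (s a)] | a <- T]) k).

(* Output decoding: N[0] = 0 means bottom; otherwise the output is the
   polynomial with coefficients Fr[0], ..., Fr[e]. *)
Definition output (F : fieldType) (e : nat) (c : config F) : option {poly F} :=
  if nreg c 0 == 0%N then None else Some (\poly_(i < e.+1) freg c i).

(* Main.v *)
(* The decoder is a Koetter-style interpolation. It processes the N constraints
   [z^j] (E(a+z) h(a) - W(a+z)) = 0, for a in T and j < s(a), one at a time, and maintains two
   pairs (E1, W1) and (E2, W2) satisfying all those processed so far. For the weighted degree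
   max (e + deg E, deg W) the first pair leads in E, with e + deg E1 = e + d1, the second one
   leads in W, with deg W2 = w2, and d1 + w2 is the number of processed constraints: at each
   step the pair of larger degree is corrected by a multiple of the other one, and one pair is
   multiplied by x - a.

   At the end d1 + w2 = N. If R is a solution, of distance D, then W - E R vanishes at the
   points of T to a total order at least N - D, so a pair of weighted degree less than N - D
   satisfies W = E R. The second pair cannot satisfy it, since W2 leads; hence w2 >= N - D,
   2 d1 + e < N, and then W1 = E1 R. Conversely, if W1 = E1 R and 2 d1 + e < N, then R has
   distance at most d1, because E1 vanishes to order s(a) - d_min at each a. So it is enough to
   divide W1 by E1, and no minimality of the pairs has to be proved. *)
Require Import Defs.
From mathcomp Require Import all_boot all_order all_algebra zify ring.
Import GRing.Theory.
Set Implicit Arguments. Unset Strict Implicit. Unset Printing Implicit Defensive.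

(** * A structured language for the RAM *)

Inductive cmd :=
| Blk (l : seq instr)
| Seq (c d : cmd)
| IfNZ (i : nat) (c d : cmd)
| IfEq (i j : nat) (c d : cmd)
| While (i : nat) (c : cmd).

Fixpoint clen (c : cmd) : nat :=
  match c with
  | Blk l => size l
  | Seq c d => clen c + clen d
  | IfNZ _ c d | IfEq _ _ c d => clen c + clen d + 2
  | While _ c => clen c + 2
  end.

(* [JmpFEq 0 0] is an unconditional jump. *)
Fixpoint compile (o : nat) (c : cmd) : seq instr :=
  match c with
  | Blk l => l
  | Seq c d => compile o c ++ compile (o + clen c) d
  | IfNZ i c d =>
      JmpNZ i (o + clen d + 2) :: compile o.+1 d
      ++ JmpFEq 0 0 (o + clen c + clen d + 2) :: compile (o + clen d + 2) c
  | IfEq i j c d =>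
      JmpFEq i j (o + clen d + 2) :: compile o.+1 d
      ++ JmpFEq 0 0 (o + clen c + clen d + 2) :: compile (o + clen d + 2) c
  | While i c =>
      JmpFEq 0 0 (o + clen c + 1) :: compile o.+1 c ++ [:: JmpNZ i o.+1]
  end.

(* Every loop is assumed to make at most [M] iterations. *)
Fixpoint cost (M : nat) (c : cmd) : nat :=
  match c with
  | Blk l => size l
  | Seq c d => cost M c + cost M d
  | IfNZ _ c d | IfEq _ _ c d => cost M c + cost M d + 2
  | While _ c => M * (cost M c + 1) + 2
  end.

Definition straight (i : instr) : bool :=
  match i with JmpNZ _ _ | JmpFEq _ _ _ | Halt => false | _ => true end.

Lemma size_compile c o : size (compile o c) = clen c.
Proof.
elim: c o => //= [c IHc d IHd|i c IHc d IHd|i j c IHc d IHd|i c IHc] o;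
  rewrite ?size_cat /= ?size_cat ?IHc ?IHd /=; lia.
Qed.

(** The exponent depends on the command alone, so one polynomial bound serves all fields and inputs.
    Since [1 < M], a sum of two powers of [M] is absorbed by one more factor [M]. *)
Lemma cost_poly c : exists d, forall M, 1 < M -> (cost M c <= M ^ d)%N.
Proof.
have add M x y d1 d2 : 1 < M -> (x <= M ^ d1)%N -> (y <= M ^ d2)%N ->
    (x + y <= M ^ (d1 + d2).+1)%N.
  move=> M1 hx hy; rewrite expnS.
  have h1 : (M ^ d1 <= M ^ (d1 + d2))%N by rewrite leq_exp2l ?leq_addr.
  have h2 : (M ^ d2 <= M ^ (d1 + d2))%N by rewrite leq_exp2l ?leq_addl.
  nia.
have two M : (1 < M)%N -> (2 <= M ^ 1)%N by rewrite expn1.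
have branch : forall c d, (exists d1, forall M, 1 < M -> (cost M c <= M ^ d1)%N) ->
    (exists d2, forall M, 1 < M -> (cost M d <= M ^ d2)%N) ->
    exists d3, forall M, 1 < M -> (cost M c + cost M d + 2 <= M ^ d3)%N.
  move=> {}c d [d1 IHc] [d2 IHd]; exists ((d1 + d2).+1 + 1).+1 => M M1.
  exact: add M1 (add _ _ _ _ _ M1 (IHc M M1) (IHd M M1)) (two M M1).
elim: c => /= [l|c [d1 IHc] d [d2 IHd]|_ c IHc d IHd|_ _ c IHc d IHd|_ c [d1 IHc]].
- by exists (size l) => M M1; apply: ltnW; apply: ltn_expl.
- exists (d1 + d2).+1 => M M1; exact: add M1 (IHc M M1) (IHd M M1).
- exact: branch.
- exact: branch.
- exists ((d1 + 1).+2 + 1).+1 => M M1.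
  have h1 : (1 <= M ^ 1)%N by rewrite expn1 ltnW.
  have h2 := add _ _ _ _ _ M1 (IHc M M1) h1.
  apply: add M1 _ (two M M1); rewrite (expnS M (d1 + 1).+1).
  exact: leq_mul.
Qed.

(** * Total-correctness triples with a time bound *)

Definition code_at (P : seq instr) (o : nat) (l : seq instr) :=
  forall i, (i < size l)%N -> fetch P (o + i) = nth Halt l i.

Lemma code_at_cons P o i l : code_at P o (i :: l) -> fetch P o = i /\ code_at P o.+1 l.
Proof.
move=> h; split; first by have := h 0 isT; rewrite addn0.
by move=> k hk; have := h k.+1 hk; rewrite addnS addSn.
Qed.

Lemma code_at_cat P o l1 l2 :
  code_at P o (l1 ++ l2) -> code_at P o l1 /\ code_at P (o + size l1) l2.
Proof.
move=> h; split=> i hi.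
  by have := h i; rewrite size_cat nth_cat hi => -> //; apply: ltn_addr.
have := h (size l1 + i); rewrite size_cat nth_cat ltn_add2l => /(_ hi).
by rewrite addnA ltnNge leq_addr /= addKn.
Qed.

Section Triples.
Context (F : fieldType).
Implicit Types (P : seq instr) (c d : cmd) (N : nat -> nat) (R : nat -> F)
  (Q : (nat -> nat) -> (nat -> F) -> Prop) (C : config F).

Lemma run_halted P k C : halted P C -> run P k C = C.
Proof. by case: k => //= k ->. Qed.

Lemma run_add P k l C : run P (k + l) C = run P l (run P k C).
Proof.
elim: k C => //= k IH C; case: ifP => [h|_]; last exact: IH.
by rewrite run_halted.
Qed.

(** Quantifying over every program [P] and offset [o] makes triples compositional: a command is
    verified before it is known where its code will sit. [M] is the bound on loop iterations used in
    [cost]. *)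
Definition tr M c N R Q := forall P o, code_at P o (compile o c) ->
  exists k N' R', [/\ (k <= cost M c)%N,
    run P k (Config o N R) = Config (o + clen c) N' R' & Q N' R'].

Lemma tr_nil M N R Q : Q N R -> tr M (Blk [::]) N R Q.
Proof. by move=> q P o _; exists 0, N, R; rewrite addn0. Qed.

(** A straight instruction only increments the program counter, so its effect on the registers can
    be computed on the one-instruction program at counter 0, whatever the real offset. *)
Lemma tr_cons M i l N R Q : straight i ->
  (let: Config _ N' R' := step [:: i] (Config 0 N R) in tr M (Blk l) N' R' Q) ->
  tr M (Blk (i :: l)) N R Q.
Proof.
case e1 : (step _ _) => [p N' R'] si h P o /= /code_at_cons[hf hc].
have [k [N1 [R1 [hk hr q]]]] := h P o.+1 hc.
exists k.+1, N1, R1; split; [exact: hk | | exact: q].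
rewrite addnS -addSn -hr /= /halted /= hf.
by move: si e1 hf {h}; case: i => //= > _ [_ <- <-] _.
Qed.

Lemma tr_seq M c d N R Q :
  tr M c N R (fun N' R' => tr M d N' R' Q) -> tr M (Seq c d) N R Q.
Proof.
move=> h P o /= /code_at_cat[hc hd].
have [k [N1 [R1 [hk r1 h1]]]] := h P o hc.
rewrite size_compile in hd.
have [l [N2 [R2 [hl r2 h2]]]] := h1 P _ hd.
exists (k + l), N2, R2; split=> //; first exact: leq_add.
by rewrite run_add r1 r2 addnA.
Qed.

Lemma run_jmp P o N R l : fetch P o = JmpFEq 0 0 l ->
  run P 1 (Config o N R) = Config l N R.
Proof. by move=> /= hf; rewrite /halted /= hf eqxx. Qed.

Lemma run_jmpNZ P o i N R l : fetch P o = JmpNZ i l ->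
  run P 1 (Config o N R) = Config (if N i != 0%N then l else o.+1) N R.
Proof. by move=> /= hf; rewrite /halted /= hf. Qed.

Lemma run_jmpFEq P o i j N R l : fetch P o = JmpFEq i j l ->
  run P 1 (Config o N R) = Config (if R i == R j then l else o.+1) N R.
Proof. by move=> /= hf; rewrite /halted /= hf. Qed.

(** Both tests share this layout: the code of [d] comes right after the test and ends with a jump
    over the code of [c]. The test and that jump account for the 2 extra steps. *)
Lemma tr_branch M (b : bool) c d N R Q P o ins :
  (run P 1 (Config o N R) = Config (if b then o + clen d + 2 else o.+1) N R)%N ->
  code_at P o (ins :: compile o.+1 d
      ++ JmpFEq 0 0 (o + clen c + clen d + 2) :: compile (o + clen d + 2) c)%N ->
  (if b then tr M c N R Q else tr M d N R Q) ->
  exists k N' R', [/\ (k <= cost M c + cost M d + 2)%N,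
    run P k (Config o N R) = Config (o + (clen c + clen d + 2)) N' R' & Q N' R'].
Proof.
move=> r0 /code_at_cons[_ /code_at_cat[hd]]; rewrite size_compile => /code_at_cons[hj hc].
case: b r0 => r0 h.
  have [|k [N1 [R1 [hk r1 h1]]]] := h P (o + clen d + 2)%N.
    have e1 : (o + clen d + 2 = (o.+1 + clen d).+1)%N by lia.
    by rewrite [X in code_at P X]e1.
  exists (1 + k)%N, N1, R1; split=> //; first lia.
  by rewrite run_add r0 r1; congr Config; lia.
have [k [N1 [R1 [hk r1 h1]]]] := h P o.+1 hd.
exists (1 + k + 1)%N, N1, R1; split=> //; first lia.
by rewrite !run_add r0 r1 (run_jmp _ _ hj); congr Config; lia.
Qed.

Lemma tr_ifnz M i c d N R Q :
  (if N i != 0%N then tr M c N R Q else tr M d N R Q) -> tr M (IfNZ i c d) N R Q.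
Proof.
move=> h P o hc; have [hf _] := code_at_cons hc.
by apply: tr_branch hc h; apply: run_jmpNZ.
Qed.

Lemma tr_ifeq M i j c d N R Q :
  (if R i == R j then tr M c N R Q else tr M d N R Q) -> tr M (IfEq i j c d) N R Q.
Proof.
move=> h P o hc; have [hf _] := code_at_cons hc.
by apply: tr_branch hc h; apply: run_jmpFEq.
Qed.

(** The index of [Inv] is the number of iterations left. Tying it to the zero test of register [i]
    gives termination and the iteration bound at once. *)
Lemma tr_while M i c N R (Inv : nat -> (nat -> nat) -> (nat -> F) -> Prop) n Q :
  (n <= M)%N -> Inv n N R ->
  (forall m N R, Inv m N R -> (N i == 0%N) = (m == 0%N)) ->
  (forall m N R, (m < n)%N -> Inv m.+1 N R -> tr M c N R (Inv m)) ->
  (forall N R, Inv 0%N N R -> Q N R) ->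
  tr M (While i c) N R Q.
Proof.
move=> nM h0 hz hb hQ P o /= /code_at_cons[hj /code_at_cat[hc]].
rewrite size_compile => /code_at_cons[hw _].
have loop m N1 R1 : (m <= n)%N -> Inv m N1 R1 ->
    exists k N' R', [/\ (k <= m * (cost M c + 1) + 1)%N,
    run P k (Config (o + clen c + 1) N1 R1) = Config (o + (clen c + 2)) N' R' & Inv 0%N N' R'].
  elim: m N1 R1 => [|m IH] N1 R1 hm hI.
    exists 1%N, N1, R1; split=> //.
    have e1 : (o + clen c + 1 = o.+1 + clen c)%N by lia.
    rewrite e1 (run_jmpNZ _ _ hw) (hz _ _ _ hI) eqxx /=; congr Config; lia.
  have [k [N2 [R2 [hk r1 h1]]]] := hb m N1 R1 hm hI P o.+1 hc.
  have [l [N3 [R3 [hl r2 h2]]]] := IH N2 R2 (ltnW hm) h1.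
  exists (1 + k + l)%N, N3, R3; split=> //; first by rewrite mulSn; lia.
  have e1 : (o + clen c + 1 = o.+1 + clen c)%N by lia.
  rewrite !run_add {1}e1 (run_jmpNZ _ _ hw) (hz _ _ _ hI) /= -r2 -e1 in r1 *.
  by rewrite r1.
have [k [N1 [R1 [hk r1 h1]]]] := loop n N R (leqnn n) h0.
exists (1 + k)%N, N1, R1; split; last exact: hQ.
  have : (n * (cost M c + 1) <= M * (cost M c + 1))%N by rewrite leq_mul2r nM orbT.
  lia.
by rewrite run_add (run_jmp _ _ hj).
Qed.

End Triples.

(** * Interpolation *)

Section Polynomials.
Local Open Scope ring_scope.
Context (F : fieldType).
Implicit Types (p q E W R : {poly F}) (T : seq F) (a c : F).

Lemma coef_mulXD p c j :
  (('X + c%:P) * p)`_j = (if j == 0%N then 0 else p`_j.-1) + c * p`_j.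
Proof. by rewrite mulrDl coefD coefXM coefCM. Qed.

Lemma coef_mulXB p c j :
  (('X - c%:P) * p)`_j = (if j == 0%N then 0 else p`_j.-1) - c * p`_j.
Proof. by rewrite -polyCN coef_mulXD mulNr. Qed.

(** Divisibility of the shifted polynomial by a power of ['X] is carried back by composing with the
    inverse shift ['X - a]. *)
Lemma dvdp_exp_shift p a m :
  (forall j, (j < m)%N -> (p \Po ('X + a%:P))`_j = 0) -> ('X - a%:P) ^+ m %| p.
Proof.
move=> h.
have d : 'X^m %| p \Po ('X + a%:P).
  rewrite -[p \Po _](poly_take_drop m) (_ : take_poly m _ = 0) ?add0r ?dvdp_mulIr //.
  by apply/polyP=> j; rewrite coef_take_poly coef0; case: ifP => // /h.
have -> : p = (p \Po ('X + a%:P)) \Po ('X - a%:P).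
  by rewrite -comp_polyA comp_polyD comp_polyX comp_polyC subrK comp_polyXr.
have := dvdp_comp_poly ('X - a%:P) d.
by rewrite rmorphXn /= comp_polyX.
Qed.

(** Powers of ['X - a] at distinct points are coprime, so their product divides [p], and its degree
    is the sum of the multiplicities. *)
Lemma sum_mult_lt_size T (m : F -> nat) p : uniq T -> p != 0 ->
  (forall a, a \in T -> forall j, (j < m a)%N -> (p \Po ('X + a%:P))`_j = 0) ->
  (\sum_(a <- T) m a < size p)%N.
Proof.
move=> uT p0 h.
have sz : size (\prod_(a <- T) ('X - a%:P) ^+ m a) = (\sum_(a <- T) m a).+1.
  rewrite size_prod_seq => [|a _]; last by rewrite expf_neq0 ?polyXsubC_eq0.
  under eq_bigr do rewrite size_exp_XsubC -addn1.
  by rewrite big_split /= sum1_size subSn ?leq_addl // addnK.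
rewrite -sz; apply: dvdp_leq => //.
elim: T uT h {sz} => [|a T IH] /= uT h; first by rewrite big_nil dvd1p.
case/andP: uT => aT uT.
rewrite big_cons Gauss_dvdp.
  rewrite dvdp_exp_shift => [|j hj]; last by apply: h; rewrite ?inE ?eqxx.
  by apply: IH => // b bT; apply: h; rewrite inE bT orbT.
apply: coprimep_expl; rewrite big_seq.
apply: (big_ind (fun q => coprimep ('X - a%:P) q)) => [|q1 q2 c1 c2|b bT].
- exact: coprimep1.
- by rewrite coprimepMr c1.
- apply: coprimep_expr; rewrite coprimep_XsubC root_XsubC.
  by apply: contraNneq aT => <-.
Qed.

Lemma dmin_le t p : (dmin t p <= t)%N.
Proof.
rewrite /dmin; elim/big_rec: _ => // i m _ hm.
by rewrite geq_min hm orbT.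
Qed.

Lemma coef_lt_dmin t p j : (j < dmin t p)%N -> p`_j = 0.
Proof.
move=> hj; apply/eqP; apply/negPn/negP => pj; move: hj; apply/negP; rewrite -leqNgt.
have js : (j < size p)%N.
  by rewrite ltnNge; apply: contra pj => hj; rewrite nth_default.
rewrite /dmin; have := mem_index_enum (Ordinal js).
elim: (index_enum _) => //= i r IH; rewrite inE big_cons => /orP[/eqP <-|/IH le_r].
  by rewrite /= pj geq_minl.
by case: ifP => // _; rewrite geq_min le_r orbT.
Qed.

Lemma coef_dmin t p : (dmin t p < t)%N -> p`_(dmin t p) != 0.
Proof.
rewrite /dmin.
apply: (big_ind (fun m => (m < t)%N -> p`_m != 0)) => [|x y hx hy|i //].
  by rewrite ltnn.
by rewrite /minn; case: ifP.
Qed.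

Lemma coef_Enc (s : F -> nat) R a j : (j < s a)%N ->
  (Enc s R a)`_j = (R \Po ('X + a%:P))`_j.
Proof. by move=> hj; rewrite /Enc -Pdiv.IdomainMonic.take_poly_modp coef_take_poly hj. Qed.

(** * The key equation and its link to the distance *)

Definition key_eq T (s : F -> nat) (h : F -> {poly F}) E W :=
  forall a, a \in T -> forall j, (j < s a)%N ->
    ((E \Po ('X + a%:P)) * h a - (W \Po ('X + a%:P)))`_j = 0.

Lemma coef_mul_low p q d j : (forall i, (i < d)%N -> p`_i = 0) -> (j < d)%N ->
  (q * p)`_j = 0.
Proof.
move=> h hj; rewrite coefM big1 // => i _; rewrite h ?mulr0 //.
by apply: leq_ltn_trans hj; apply: leq_subr.
Qed.

(** After the shift, [W - E * R] is [E (h - R) - (E h - W)]. The second term vanishes below [s a];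
    the first one vanishes below the order of [h a - Enc s R a], as [Enc] keeps the coefficients of
    the shifted [R] below [s a]. *)
Lemma key_eq_low T s h E W R a j : key_eq T s h E W -> a \in T ->
  (j < dmin (s a) (h a - Enc s R a))%N -> ((W - E * R) \Po ('X + a%:P))`_j = 0.
Proof.
move=> key aT hj.
have hs := leq_trans hj (dmin_le _ _).
have -> : (W - E * R) \Po ('X + a%:P) =
    (E \Po ('X + a%:P)) * (h a - (R \Po ('X + a%:P)))
      - ((E \Po ('X + a%:P)) * h a - (W \Po ('X + a%:P))).
  by rewrite comp_polyB comp_polyM; ring.
rewrite coefB key // subr0; apply: coef_mul_low hj => i hi.
have := coef_lt_dmin hi; rewrite !coefB coef_Enc //.
exact: leq_trans hi (dmin_le _ _).
Qed.

(** Otherwise [W - E * R] would be nonzero with a total vanishing order, at least N minus the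
    distance, that is not below its size. *)
Lemma key_eq_quotient T s h E W R : uniq T -> key_eq T s h E W ->
  (size (W - E * R)%R + Delta_mult T s h (Enc s R) <= \sum_(a <- T) s a)%N ->
  W = E * R.
Proof.
move=> uT key hs; apply/eqP; rewrite -subr_eq0; apply/negPn/negP => n0.
have := @sum_mult_lt_size T (fun a => dmin (s a) (h a - Enc s R a)) _ uT n0
  (fun a aT j => @key_eq_low T s h E W R a j key aT).
apply/negP; rewrite -leqNgt -(leq_add2r (Delta_mult T s h (Enc s R))).
apply: leq_trans hs _.
rewrite /Delta_mult -big_split /=; apply: leq_sum => a _.
by rewrite subnKC // dmin_le.
Qed.

(** At each point [E (h - R)] vanishes modulo [z^(s a)] while [h - R] has order exactly [d] whenever
    [d < s a]; hence [E] itself vanishes there to order [s a - d], and these orders add up to the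
    distance. *)
Lemma Delta_lt_size T s h E R : uniq T -> E != 0 -> key_eq T s h E (E * R) ->
  (Delta_mult T s h (Enc s R) < size E)%N.
Proof.
move=> uT E0 key; apply: sum_mult_lt_size => // a aT j.
set rho := h a - _; set d := dmin _ _.
have rho_low i : (i < d)%N -> rho`_i = 0 by apply: coef_lt_dmin.
have prod0 i : (i < s a)%N -> ((E \Po ('X + a%:P)) * rho)`_i = 0.
  move=> hi;  have := key a aT i hi; rewrite comp_polyM -mulrBr => H.
  rewrite -[RHS]H !coefM; apply: eq_bigr => k _.
  rewrite /rho !coefB coef_Enc //.
  by apply: leq_ltn_trans hi; apply: leq_subr.
elim/ltn_ind: j => j IH hj.
have rd : rho`_d != 0 by apply: coef_dmin; lia.
have jd : (j < (j + d).+1)%N by lia.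
(* In the coefficient of index [j + d] only the term with index [j] in [E] survives: smaller indices
   vanish by induction, larger ones meet a coefficient of [rho] below [d]. *)
have := prod0 (j + d)%N; rewrite coefM (bigD1 (Ordinal jd)) //= addKn big1.
  rewrite addr0 => /(_ _)/eqP; rewrite mulf_eq0 (negPf rd) orbF => H.
  by apply/eqP/H; lia.
move=> [i hi]; rewrite -val_eqE /= => ij.
have [lt_ij|ge_ij] := ltnP i j; first by rewrite IH ?mul0r //; lia.
by rewrite rho_low ?mulr0 //; lia.
Qed.

(* For the weighted degree max (e + deg E, deg W), the first pair leads in its [E] component,
   with degree [e + d1], and the second one in its [W] component, with degree [w2]. *)
Record good (e d1 w2 : nat) E1 W1 E2 W2 : Prop := Good {
  good_lead1 : E1`_d1 != 0;
  good_E1 : forall k, (d1 < k)%N -> E1`_k = 0;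
  good_W1 : forall k, (e + d1 < k)%N -> W1`_k = 0;
  good_lead2 : W2`_w2 != 0;
  good_W2 : forall k, (w2 < k)%N -> W2`_k = 0;
  good_E2 : forall k, (w2 <= e + k)%N -> E2`_k = 0 }.

Lemma good0 e : good e 0%N 0%N 1 0 0 1.
Proof.
by split=> [|[|k] // _|k _||[|k] // _|k _]; rewrite ?coef1 ?coef0 ?oner_eq0.
Qed.

Lemma good_mul1 e d1 w2 E1 W1 E2 W2 a : good e d1 w2 E1 W1 E2 W2 ->
  good e d1.+1 w2 (('X - a%:P) * E1) (('X - a%:P) * W1) E2 W2.
Proof.
case=> l1 e1 w1 l2 hw2 e2; split=> // [|k hk|k hk]; rewrite coef_mulXB.
- by rewrite /= (e1 d1.+1) // mulr0 subr0.
- by case: k hk => //= k hk; rewrite !e1 ?mulr0 ?subr0 //; lia.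
- by case: k hk => //= k hk; rewrite !w1 ?mulr0 ?subr0 //; lia.
Qed.

Lemma good_mul2 e d1 w2 E1 W1 E2 W2 a : good e d1 w2 E1 W1 E2 W2 ->
  good e d1 w2.+1 E1 W1 (('X - a%:P) * E2) (('X - a%:P) * W2).
Proof.
case=> l1 e1 w1 l2 hw2 e2; split=> // [|k hk|k hk]; rewrite coef_mulXB.
- by rewrite /= (hw2 w2.+1) // mulr0 subr0.
- by case: k hk => //= k hk; rewrite !hw2 ?mulr0 ?subr0 //; lia.
- rewrite (e2 k) ?mulr0 ?subr0; last lia.
  by case: k hk => //= k hk; rewrite e2 //; lia.
Qed.

(** The lead of [E1] survives even for [w2 = e + d1], because [E2] vanishes from index [w2 - e]
    on. *)
Lemma good_add1 e d1 w2 E1 W1 E2 W2 c : (w2 <= e + d1)%N ->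
  good e d1 w2 E1 W1 E2 W2 -> good e d1 w2 (E1 + c *: E2) (W1 + c *: W2) E2 W2.
Proof.
move=> h [l1 e1 w1 l2 hw2 e2]; split=> // [|k hk|k hk]; rewrite coefD coefZ.
- by rewrite e2 // mulr0 addr0.
- by rewrite e1 // e2 ?mulr0 ?addr0 //; lia.
- by rewrite w1 // hw2 ?mulr0 ?addr0 //; lia.
Qed.

(** Here the inequality is strict because [W1] may have a nonzero coefficient at index [e + d1],
    which must stay below the lead of [W2]. *)
Lemma good_add2 e d1 w2 E1 W1 E2 W2 c : (e + d1 < w2)%N ->
  good e d1 w2 E1 W1 E2 W2 -> good e d1 w2 E1 W1 (E2 + c *: E1) (W2 + c *: W1).
Proof.
move=> h [l1 e1 w1 l2 hw2 e2]; split=> // [|k hk|k hk]; rewrite coefD coefZ.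
- by rewrite w1 // mulr0 addr0.
- by rewrite hw2 // w1 ?mulr0 ?addr0 //; lia.
- by rewrite e2 // e1 ?mulr0 ?addr0 //; lia.
Qed.

(** * Completeness and soundness of the quotient test *)

Section Decode.
Context (T : seq F) (s : F -> nat) (h : F -> {poly F}) (e d1 w2 : nat)
  (E1 W1 E2 W2 : {poly F}).
Let n := (\sum_(a <- T) s a)%N.
Context (uT : uniq T) (gd : good e d1 w2 E1 W1 E2 W2) (sum_w : (d1 + w2 = n)%N)
  (key1 : key_eq T s h E1 W1) (key2 : key_eq T s h E2 W2).

Lemma size_sub_mul (E W R : {poly F}) k : (size W <= k)%N -> (forall i, (k <= e + i)%N -> E`_i = 0) ->
  (size R <= e.+1)%N -> (size (W - E * R)%R <= k)%N.
Proof.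
move=> sW sE sR; apply: leq_trans (size_polyD _ _) _; rewrite geq_max sW size_polyN /=.
apply/leq_sizeP => j hj; rewrite coefM big1 // => [[i hi] _] /=.
have [lt_i|ge_i] := ltnP (e + i) k; last by rewrite sE ?mul0r.
by rewrite [X in _ * X]nth_default ?mulr0 //; apply: leq_trans sR _; lia.
Qed.

Lemma decode_complete R : (size R <= e.+1)%N ->
  (2 * Delta_mult T s h (Enc s R) + e < n)%N -> (2 * d1 + e < n)%N /\ W1 = E1 * R.
Proof.
move=> sR; set D := Delta_mult _ _ _ _ => hD.
case: gd => l1 e1 w1 l2 hw2 e2.
have w2_big : (n <= w2 + D)%N.
  rewrite leqNgt; apply/negP => hs; move: l2.
  have -> : W2 = E2 * R.
    apply: (@key_eq_quotient T s h) => //; apply: leq_trans hs; rewrite -addSn leq_add2r.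
    apply: size_sub_mul => // [|i hi]; last by apply: e2; lia.
    by apply/leq_sizeP => j; apply: hw2.
  (* The coefficient of index [w2] in [E2 * R] is 0: a nonzero coefficient of [E2] has [e + i < w2],
     which leaves an index above [e] for [R]. This contradicts the lead of [W2]. *)
  rewrite coefM big1 ?eqxx // => [[i hi] _] /=.
  have [lt_i|ge_i] := ltnP (e + i) w2; last by rewrite e2 ?mul0r.
  by rewrite [X in _ * X]nth_default ?mulr0 //; apply: leq_trans sR _; lia.
split; first lia.
apply: (@key_eq_quotient T s h) => //; rewrite -/D.
apply: (@leq_trans ((e + d1).+1 + D)); last lia.
rewrite leq_add2r; apply: size_sub_mul => // [|i hi]; last by apply: e1; lia.
by apply/leq_sizeP => j; apply: w1.
Qed.

Lemma decode_sound R : W1 = E1 * R -> (2 * d1 + e < n)%N ->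
  (2 * Delta_mult T s h (Enc s R) + e < n)%N.
Proof.
move=> eW hd; case: gd => l1 e1 _ _ _ _.
have E0 : E1 != 0 by apply: contraNneq l1 => ->; rewrite coef0.
have := @Delta_lt_size T s h E1 R uT E0; rewrite -eW => /(_ key1).
have : (size E1 <= d1.+1)%N by apply/leq_sizeP => j; apply: e1.
by move=> h1 h2; lia.
Qed.

End Decode.

(* A block [(a, u, v)] stands for the linear map [(E, W) |-> E(a+z) u + W(a+z) v], and an
   entry for one coefficient of it. The blocks [(a, h a, -1)] give the residuals, while
   [(0, 1, 0)] and [(0, 0, -1)] store [E] and [- W] themselves, so that multiplication by
   [x - c] acts in the same way on all entries of a flat array. *)
Definition block : Type := F * {poly F} * {poly F}.

Definition pv (b : block) E W : {poly F} :=
  (E \Po ('X + b.1.1%:P)) * b.1.2 + (W \Po ('X + b.1.1%:P)) * b.2.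

Lemma pv_add b E1 W1 E2 W2 c :
  pv b (E1 + c *: E2) (W1 + c *: W2) = pv b E1 W1 + c *: pv b E2 W2.
Proof. by rewrite /pv !comp_polyD !comp_polyZ -!mul_polyC; ring. Qed.

(** With [x = a + z], the factor [x - c] becomes [z + (a - c)]. Hence each new coefficient of a
    block combines the old one and its predecessor. *)
Lemma pv_mul b E W c :
  pv b (('X - c%:P) * E) (('X - c%:P) * W) = ('X + (b.1.1 - c)%:P) * pv b E W.
Proof. by rewrite /pv !comp_polyM !comp_polyB !comp_polyX !comp_polyC polyCB; ring. Qed.

Definition entry_val (x : block * nat) E W : F := (pv x.1 E W)`_x.2.

Definition entries (bl : seq (block * nat)) : seq (block * nat) :=
  flatten [seq [seq (b.1, j) | j <- iota 0 b.2] | b <- bl].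

Lemma entries_cons b bl :
  entries (b :: bl) = [seq (b.1, j) | j <- iota 0 b.2] ++ entries bl.
Proof. by []. Qed.

Lemma entries_cat bl1 bl2 : entries (bl1 ++ bl2) = entries bl1 ++ entries bl2.
Proof. by rewrite /entries map_cat flatten_cat. Qed.

Lemma size_entries bl : size (entries bl) = (\sum_(b <- bl) b.2)%N.
Proof.
elim: bl => [|b bl IH]; first by rewrite big_nil.
by rewrite entries_cons size_cat size_map size_iota big_cons IH.
Qed.

Definition x0 : block * nat := ((0, 0, 0), 0%N).

Lemma nth_entries b bl i : nth x0 (entries (b :: bl)) i =
  if (i < b.2)%N then (b.1, i) else nth x0 (entries bl) (i - b.2).
Proof.
rewrite entries_cons nth_cat size_map size_iota; case: ifP => // hi.
by rewrite (nth_map 0%N) ?size_iota ?nth_iota.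
Qed.

(** This justifies the flat array: the coefficient preceding a given one in its block sits in the
    cell just before. *)
Lemma entries_pred bl i b j : (i < size (entries bl))%N ->
  nth x0 (entries bl) i = (b, j.+1) -> exists2 k, i = k.+1 & nth x0 (entries bl) k = (b, j).
Proof.
elim: bl i => [|[b1 l] bl IH] i //.
rewrite entries_cons size_cat size_map size_iota !nth_entries /=.
case: ifP => hi hi2.
  case=> <- ij; exists j => //; rewrite -(entries_cons (b1, l)) nth_entries /= ifT //; lia.
case/IH=> [|k ik nk]; first lia.
exists (l + k)%N; first lia.
by rewrite -(entries_cons (b1, l)) nth_entries /= ifF ?addKn //; lia.
Qed.

(** The 0/1 factor masks the previous cell at the start of a block, where that cell belongs to
    another block or lies outside the array. *)
Lemma val_mul bl i E W c : (i < size (entries bl))%N ->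
  entry_val (nth x0 (entries bl) i) (('X - c%:P) * E) (('X - c%:P) * W) =
  ((nth x0 (entries bl) i).2 != 0%N)%:R * entry_val (nth x0 (entries bl) i.-1) E W
  + ((nth x0 (entries bl) i).1.1.1 - c) * entry_val (nth x0 (entries bl) i) E W.
Proof.
move=> hi; rewrite /entry_val pv_mul coef_mulXD.
case ei : (nth _ _ i) => [b [|j]] /=; first by rewrite mul0r.
by have [k -> -> /=] := entries_pred hi ei; rewrite mul1r.
Qed.

Lemma val_add x E1 W1 E2 W2 c :
  entry_val x (E1 + c *: E2) (W1 + c *: W2) = entry_val x E1 W1 + c * entry_val x E2 W2.
Proof. by rewrite /entry_val pv_add coefD coefZ. Qed.

Definition Tblocks T (s : F -> nat) (h : F -> {poly F}) : seq (block * nat) :=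
  [seq ((a, h a, -1), s a) | a <- T].

(** [m] truncates the stored [E] and [- W]. Truncation is harmless during the updates, since
    multiplication by [x - c] never uses a coefficient of higher index. *)
Definition blocks T s h m : seq (block * nat) :=
  Tblocks T s h ++ [:: ((0, 1, 0), m); ((0, 0, -1), m)].

Lemma size_Tentries T s h : size (entries (Tblocks T s h)) = (\sum_(a <- T) s a)%N.
Proof. by rewrite size_entries big_map. Qed.

Lemma nth_blocksT T s h m i : (i < \sum_(a <- T) s a)%N ->
  nth x0 (entries (blocks T s h m)) i = nth x0 (entries (Tblocks T s h)) i.
Proof. by move=> hi; rewrite entries_cat nth_cat size_Tentries hi. Qed.

Lemma nth_blocksE T s h m i : (i < m)%N ->
  nth x0 (entries (blocks T s h m)) (\sum_(a <- T) s a + i) = ((0, 1, 0), i).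
Proof.
move=> hi; rewrite entries_cat nth_cat size_Tentries ltnNge leq_addr /= addKn.
by rewrite nth_entries /= hi.
Qed.

Lemma nth_blocksW T s h m i : (i < m)%N ->
  nth x0 (entries (blocks T s h m)) (\sum_(a <- T) s a + m + i) = ((0, 0, -1), i).
Proof.
move=> hi; rewrite entries_cat nth_cat size_Tentries -addnA ltnNge leq_addr /= addKn.
by rewrite !nth_entries /= ltnNge leq_addr /= addKn hi.
Qed.

Lemma size_blocks T s h m :
  size (entries (blocks T s h m)) = (\sum_(a <- T) s a + m + m)%N.
Proof. by rewrite size_entries big_cat /= !big_cons big_nil big_map /=; lia. Qed.

Lemma valE E W j : entry_val ((0, 1, 0), j) E W = E`_j.
Proof. by rewrite /entry_val /pv /= addr0 !comp_polyXr mulr1 mulr0 addr0. Qed.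

Lemma valW E W j : entry_val ((0, 0, -1), j) E W = - W`_j.
Proof. by rewrite /entry_val /pv /= addr0 !comp_polyXr mulr0 add0r mulrN1 coefN. Qed.

Lemma val10 x : entry_val x 1 0 = x.1.1.2`_x.2.
Proof. by rewrite /entry_val /pv comp_poly0 comp_polyC mul1r mul0r addr0. Qed.

Lemma val01 x : entry_val x 0 1 = x.1.2`_x.2.
Proof. by rewrite /entry_val /pv comp_poly0 comp_polyC mul1r mul0r add0r. Qed.

Lemma key_eq_val T s h m E W :
  (forall i, (i < \sum_(a <- T) s a)%N -> entry_val (nth x0 (entries (blocks T s h m)) i) E W = 0) ->
  key_eq T s h E W.
Proof.
move=> H a aT j hj.
have : ((a, h a, -1), j) \in entries (Tblocks T s h).
  apply/flattenP; exists [seq ((a, h a, -1), j) | j <- iota 0 (s a)].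
    by apply/mapP; exists ((a, h a, -1), s a) => //; apply: map_f.
  by apply: map_f; rewrite mem_iota.
move=> /(nthP x0)[i hi ei]; rewrite size_Tentries in hi.
by have := H i hi; rewrite nth_blocksT // ei /entry_val /pv /= mulrN1.
Qed.

(** The factor is taken at the point of entry [k], so the multiple of the old entry [k] cancels and
    only its predecessor, already 0, contributes. Earlier entries combine zeros. *)
Lemma val_mul_zero bl i k E W : (i <= k)%N -> (k < size (entries bl))%N ->
  (forall l, (l < k)%N -> entry_val (nth x0 (entries bl) l) E W = 0) ->
  entry_val (nth x0 (entries bl) i) (('X - (nth x0 (entries bl) k).1.1.1%:P) * E)
    (('X - (nth x0 (entries bl) k).1.1.1%:P) * W) = 0.
Proof.
move=> ik hk H; rewrite val_mul ?(leq_ltn_trans ik) //.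
have [->|neq_ik] := eqVneq i k.
  rewrite subrr mul0r addr0; case ek: (nth _ _ k) => [b [|j]] /=; first by rewrite mul0r.
  have [l ek1 _] := entries_pred hk ek.
  by rewrite H ?mulr0 //; lia.
rewrite (H i) ?mulr0 ?addr0; last lia.
by rewrite H ?mulr0 //; lia.
Qed.

End Polynomials.

(** * The decoder *)

Definition agree (rs : seq nat) (N N' : nat -> nat) := forall r, r \notin rs -> N' r = N r.

(** * Symbolic execution of straight-line blocks *)

Ltac rd0 := repeat match goal with
  | |- context [upd ?f ?i ?x ?j] =>
    let b := eval compute in (j == i) in
    lazymatch b with
    | true => change (upd f i x j) with x
    | false => change (upd f i x j) with (f j)
    | _ => change (upd f i x j) with (if j == i then x else f j)
    end
  end.
Ltac rd := rd0; rewrite /=.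
Ltac dif := repeat match goal with
  | |- context [if ?b then _ else _] =>
    lazymatch b with
    | context [if _ then _ else _] => fail
    | _ => first [rewrite (_ : b = false); [|by lia] | rewrite (_ : b = true); [|by lia]]; cbv iota
    end
  end.
Ltac exec := match goal with |- tr ?M ?c ?N ?R ?Q =>
    let q := fresh "q" in pose q := Q; change (tr M c N R q);
    repeat (apply: tr_cons; [by [] | cbn [step fetch nth]; rd; dif]);
    apply: tr_nil; unfold q; clear q; cbv beta
  end.
Ltac agr_start := let r := fresh in let hr := fresh in
  move=> r hr; move: (hr); rewrite !inE => ?; rd; dif.
Ltac agr0 := agr_start; reflexivity.
Ltac agr ag := agr_start; apply: ag; rewrite ?inE; by lia.

(* Register map. [N1] = 1; [N2] = |T|; [N3] = N; [N4] = e; [N5], [N6]: bases of the arrays of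
   the two pairs (E1, W1), (E2, W2); [N7] = e + d1 and [N8] = w2, their weighted degrees;
   [N9], [N10]: bases of the tables giving, for each entry, its point and 0
   if it starts a block, 1 otherwise; [N11]: length of these four arrays; [N12]: current constraint;
   [N17] = 2N; [N18]: base of the copy of s; [N19]: base of the copy of the field input.
   The remaining low registers and [Fr0], ..., [Fr7] are scratch, and the division reuses
   [N8] and [N12]. *)
Definition axpy (p q : nat) : cmd :=
  While 15 (Blk [:: NSub 15 15 1; NAdd 14 p 15; FLoad 0 14; FMul 0 0 3;
                    NAdd 14 q 15; FLoad 1 14; FAdd 0 0 1; FStore 14 0]).

Section InnerLoops.
Context (F : fieldType).
Implicit Types (N : nat -> nat) (R : nat -> F).

Lemma axpy_ok M p q N R L X Y Q :
  (p < 14)%N -> (q < 14)%N -> N 1 = 1%N -> N 15 = L -> N p = X -> N q = Y ->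
  (L <= M)%N -> (8 <= X)%N -> (8 <= Y)%N -> (X + L <= Y)%N || (Y + L <= X)%N ->
  (forall N' R', agree [:: 14; 15] N N' ->
     (forall x, (1 < x)%N -> R' x =
        if (Y <= x < Y + L)%N then (R x + R (x - Y + X)%N * R 3)%R else R x) -> Q N' R') ->
  tr M (axpy p q) N R Q.
Proof.
move=> hp hq n1 n15 np nq LM X8 Y8 XY hQ.
apply: (@tr_while _ _ _ _ _ _ (fun m N' R' => [/\ (m <= L)%N, N' 15 = m, agree [:: 14; 15] N N' &
  forall x, (1 < x)%N -> R' x =
        if (Y + m <= x < Y + L)%N then (R x + R (x - Y + X)%N * R 3)%R else R x]) L) => //.
- split=> // x x1; dif => //.
- by move=> m N' R' [_ ->].
- move=> m N1 R1 hm [_ h15 ag hR]; exec.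
  have h1 : N1 1 = 1%N by rewrite ag.
  have hp1 : N1 p = X by rewrite ag ?np // !inE; lia.
  have hq1 : N1 q = Y by rewrite ag ?nq // !inE; lia.
  split.
  + lia.
  + by rd; lia.
  + by agr ag.
  + move=> x x1; rd; dif; rewrite h15 h1 hp1 hq1 subn1 /= !hR; try lia.
    case: eqP => [->|ne]; dif; last by congr (if _ then _ else _); lia.
    by rewrite addrC addKn (addnC m).
- by move=> N' R' [_ _ ag hR]; apply: hQ => // x hx; rewrite hR // addn0.
Qed.

(** The array is updated in place from the last cell to the first, so the predecessor of a cell is
    read before it changes. [Fr7] holds the opposite of the point in [Fr4]. *)
Definition mulx (r : nat) : cmd :=
  Seq (Blk [:: NConst 14 0; NAdd 15 11 14; FOpp 7 4])
    (While 15 (Blk [:: NSub 15 15 1; NAdd 14 9 15; FLoad 0 14; FAdd 0 0 7;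
       NAdd 14 10 15; FLoad 1 14; NAdd 14 r 15; FLoad 2 14; FMul 0 0 2;
       NSub 14 14 1; FLoad 2 14; FMul 1 1 2; FAdd 0 1 0; NAdd 14 r 15; FStore 14 0])).

Lemma mulx_ok M r N R L X C3 C4 Q :
  r < 14 -> N 1 = 1 -> N 9 = C3 -> N 10 = C4 -> N 11 = L -> N r = X ->
  L <= M -> 9 <= X -> X + L <= C3 -> X + L <= C4 ->
  (forall N' R', agree [:: 14; 15] N N' ->
     (forall x, 2 < x -> x != 7 -> R' x =
        if X <= x < X + L then
          (R (C4 + (x - X))%N * R x.-1 + (R (C3 + (x - X))%N - R 4) * R x)%R
        else R x) -> Q N' R') ->
  tr M (mulx r) N R Q.
Proof.
move=> hr n1 n9 n10 n11 nr LM X9 XC3 XC4 hQ.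
apply: tr_seq; exec.
apply: (@tr_while _ _ _ _ _ _ (fun m N' R' => [/\ m <= L, N' 15 = m, agree [:: 14; 15] N N',
  R' 7 = (- R 4)%R &
  forall x, 2 < x -> x != 7 -> R' x =
        if X + m <= x < X + L then
          (R (C4 + (x - X))%N * R x.-1 + (R (C3 + (x - X))%N - R 4) * R x)%R
        else R x]) L) => //.
- split=> //.
  + by rd; rewrite n11 addn0.
  + by agr0.
  + by move=> x x2 x7; rd; dif.
- by move=> m N' R' [_ ->].
- move=> m N1 R1 hm [_ h15 ag h7 hR]; exec.
  have h1 : N1 1 = 1 by rewrite ag.
  have h9 : N1 9 = C3 by rewrite ag.
  have h10 : N1 10 = C4 by rewrite ag.
  have hr1 : N1 r = X by rewrite ag ?nr // !inE; lia.
  split.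
  + lia.
  + by rd; lia.
  + by agr ag.
  + by rd; rewrite h7; dif.
  + move=> x x2 x7; rd; dif; rewrite h15 h1 h9 h10 hr1 h7 !subn1 /= !hR; try lia.
    case: eqP => [->|ne]; dif; last by congr (if _ then _ else _); lia.
    by rewrite addKn.
- by move=> N' R' [_ _ ag _ hR]; apply: hQ => // x hx h7; rewrite hR // addn0.
Qed.

End InnerLoops.

(** * One interpolation step *)

Section Elimination.
Context (F : fieldType).
Implicit Types (N : nat -> nat) (R : nat -> F).

Definition rep (ents : seq (block F * nat)) R X (E W : {poly F}) :=
  forall j, j < size ents -> R (X + j) = entry_val (nth (x0 F) ents j) E W.

Definition tables (ents : seq (block F * nat)) R C3 C4 :=
  forall j, j < size ents -> R (C3 + j) = (nth (x0 F) ents j).1.1.1 /\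
    R (C4 + j) = ((nth (x0 F) ents j).2 != 0)%:R%R.

(** Pair [p] is the pivot: [- dq / dp] times it is added to pair [q], for residuals [dp] and [dq].
    If [dp = 0], the convention [0^-1 = 0] makes the multiplier 0; the pivot already satisfies the
    constraint and pair [q] is multiplied by [x - a] instead. *)
Definition elim (p q wp wq : nat) : cmd :=
  Seq (Blk [:: NAdd 14 p 12; FLoad 6 14; NAdd 14 q 12; FLoad 2 14; FInv 3 6;
               FMul 3 2 3; FOpp 3 3; NConst 14 0; NAdd 15 11 14; FZero 5])
    (Seq (axpy p q)
      (IfEq 6 5 (Seq (mulx q) (Blk [:: NAdd wq wq 1]))
                (Seq (mulx p) (Blk [:: NAdd wp wp 1])))).

(** The boolean [b] tells which pair was multiplied by [x - a], [true] standing for [q]; only the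
    degree counter of that pair moves. *)
Lemma elim_ok M p q wp wq bl i N R L X Y C3 C4 Ep Wp Eq Wq Q :
  let ents := entries bl in
  let a := (nth (x0 F) ents i).1.1.1 in
  p < 7 -> q < 7 -> 1 < wp < 9 -> 1 < wq < 9 ->
  N 1 = 1 -> N 9 = C3 -> N 10 = C4 -> N 11 = L -> N 12 = i -> N p = X -> N q = Y ->
  R 4 = a -> L = size ents -> i < L ->
  L <= M -> 9 <= X -> 9 <= Y -> X + L <= C3 -> X + L <= C4 -> Y + L <= C3 -> Y + L <= C4 ->
  (X + L <= Y) || (Y + L <= X) ->
  rep ents R X Ep Wp -> rep ents R Y Eq Wq -> tables ents R C3 C4 ->
  (forall N' R' c w (b : bool), agree [:: 14; 15; w] N N' ->
    N' w = (N w).+1 -> w = (if b then wq else wp) ->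
    (forall x, 7 < x -> (x < X) || (X + L <= x) -> (x < Y) || (Y + L <= x) -> R' x = R x) ->
    let E' := (Eq + c *: Ep)%R in let W' := (Wq + c *: Wp)%R in
    let m := ('X - a%:P)%R in
    (if b then entry_val (nth (x0 F) ents i) Ep Wp = 0%R /\ rep ents R' X Ep Wp
         /\ rep ents R' Y (m * E')%R (m * W')%R
     else entry_val (nth (x0 F) ents i) E' W' = 0%R /\ rep ents R' X (m * Ep)%R (m * Wp)%R
         /\ rep ents R' Y E' W') -> Q N' R') ->
  tr M (elim p q wp wq) N R Q.
Proof.
move=> ents a hp hq hwp hwq n1 n9 n10 n11 n12 np nq r4 Ls iL LM X9 Y9 XC3 XC4 YC3 YC4 XY
  repX repY tab hQ.
apply: tr_seq; exec; rd; dif; rewrite n12 np nq n11 addn0.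
set N1 := upd _ _ _; set R1 := upd _ _ _.
have ag1 : agree [:: 14; 15] N N1 by rewrite /N1; agr0.
set dp := R (X + i); set dq := R (Y + i).
have hR1 x : 7 < x -> R1 x = R x by move=> x7; rewrite /R1; rd; dif.
have r3 : R1 3 = (- (dq * dp^-1))%R by rewrite /R1; rd.
have r6 : R1 6 = dp by rewrite /R1; rd.
have r41 : R1 4 = R 4 by rewrite /R1; rd.
have r5 : R1 5 = 0%R by rewrite /R1; rd.
have n1p : N1 p = X by rewrite ag1 ?np // !inE; lia.
have n1q : N1 q = Y by rewrite ag1 ?nq // !inE; lia.
have n11' : N1 1 = 1 by rewrite ag1.
have n115 : N1 15 = L by rewrite /N1; rd.
apply: tr_seq; apply: (@axpy_ok _ _ _ _ _ _ L X Y) => //; try lia.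
move=> N2 R2 ag2 hR2.
have {ag1}ag2 : agree [:: 14; 15] N N2 by move=> r hr; rewrite ag2 // ag1.
have r62 : R2 6 = dp by rewrite hR2 //; dif.
have r42 : R2 4 = a by rewrite hR2 //; dif; rewrite r41.
apply: tr_ifeq; rewrite [R2 5]hR2 // r62; dif; rewrite r5.
set c := (- (dq * dp^-1))%R in r3.
have repX2 : rep ents R2 X Ep Wp.
  by move=> j hj; rewrite hR2; [dif; rewrite hR1 ?repX //; lia | lia].
have repY2 : rep ents R2 Y (Eq + c *: Ep) (Wq + c *: Wp).
  move=> j hj; rewrite hR2; [dif | lia].
  have -> : Y + j - Y + X = X + j by lia.
  by rewrite (hR1 (Y + j)) ?(hR1 (X + j)) ?repY ?repX ?val_add ?r3 1?mulrC //; lia.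
have tab2 : tables ents R2 C3 C4.
  move=> j hj; have [t1 t2] := tab j hj.
  by rewrite !hR2; try lia; dif; rewrite (hR1 (C3 + j)) ?(hR1 (C4 + j)) //; lia.
have frame2 x : 7 < x -> (x < Y) || (Y + L <= x) -> R2 x = R x.
  by move=> x7 xY; rewrite hR2; [dif; apply: hR1 | lia].
have mul_rep r Z E W : r < 7 -> N r = Z -> 9 <= Z -> Z + L <= C3 -> Z + L <= C4 ->
    rep ents R2 Z E W -> forall Q,
    (forall N' R', agree [:: 14; 15] N N' ->
      rep ents R' Z (('X - a%:P) * E)%R (('X - a%:P) * W)%R ->
      (forall x, 7 < x -> (x < Z) || (Z + L <= x) -> R' x = R2 x) -> Q N' R') ->
    tr M (mulx r) N2 R2 Q.
  move=> hr nr Z9 ZC3 ZC4 repZ Q' hQ'.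
  have n2r : N2 r = Z by rewrite ag2 ?nr // !inE; lia.
  have [n21 n29 n210 n211] : [/\ N2 1 = 1, N2 9 = C3, N2 10 = C4 & N2 11 = L].
    by rewrite !ag2.
  apply: (@mulx_ok _ _ _ _ _ L Z C3 C4) => //; try lia.
  move=> N3 R3 ag3 hR3; apply: hQ'.
  - by move=> r' hr'; rewrite ag3 // ag2.
  - move=> j hj; rewrite hR3; try lia; dif; rewrite addKn r42.
    have [-> ->] := tab2 j hj.
    rewrite repZ // val_mul // -/ents.
    case: j hj => [|j] hj; last by rewrite addnS /= repZ //; lia.
    (* The cell before the array is read too, but the first entry must have index 0 in its block,
       since [entries_pred] would otherwise give it a predecessor; so its flag is 0. *)
    case: (nth _ _ 0) (fun k b => @entries_pred _ bl 0 b k hj) => [b [|k]] /= H.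
      by rewrite !mul0r.
    by have [] := H k b erefl.
  - by move=> x x7 xZ; rewrite hR3; [dif | lia | lia].
case: eqP => dp0.
  apply: tr_seq; apply: (mul_rep q Y _ _ _ _ _ _ _ repY2) => //.
  move=> N3 R3 ag3 rep3 fr3; exec.
  apply: (hQ _ _ c wq true) => //.
  - by agr ag3.
  - by rd; dif; rewrite !ag3 ?n1 ?addn1 // !inE; lia.
  - by move=> x x7 xX xY; rewrite fr3 // frame2.
  - split; first by rewrite -repX -?Ls.
    by split=> // j hj; rewrite fr3 ?repX2 //; lia.
apply: tr_seq; apply: (mul_rep p X _ _ _ _ _ _ _ repX2) => //.
move=> N3 R3 ag3 rep3 fr3; exec.
apply: (hQ _ _ c wp false) => //.
- by agr ag3.
- by rd; dif; rewrite !ag3 ?n1 ?addn1 // !inE; lia.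
- by move=> x x7 xX xY; rewrite fr3 // frame2.
- split.
    rewrite val_add -repX -?Ls // -repY -?Ls // -/dp -/dq /c mulNr divfK ?subrr //.
    exact/eqP.
  by split=> // j hj; rewrite fr3 ?repY2 //; lia.
Qed.
End Elimination.

(** * The interpolation loop *)

Section MainLoop.
Context (F : fieldType).
Implicit Types (N : nat -> nat) (R : nat -> F).

(** Register 16 is nonzero exactly when [w2 > e + d1]. The pivot is thus the pair of smaller
    weighted degree, and the second pair in case of equality, as [good_add1] and [good_add2]
    require. *)
Definition kloop : cmd :=
  While 13 (Seq (Blk [:: NSub 13 13 1; NSub 16 8 7; NAdd 14 9 12; FLoad 4 14])
    (Seq (IfNZ 16 (elim 5 6 7 8) (elim 6 5 8 7)) (Blk [:: NAdd 12 12 1]))).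

Definition solved (ents : seq (block F * nat)) n (E W : {poly F}) :=
  forall j, j < n -> entry_val (nth (x0 F) ents j) E W = 0%R.

Lemma solved_add ents n E1 W1 E2 W2 c : solved ents n E1 W1 -> solved ents n E2 W2 ->
  solved ents n (E1 + c *: E2)%R (W1 + c *: W2)%R.
Proof. by move=> h1 h2 j hj; rewrite val_add h1 // h2 // mulr0 addr0. Qed.

Lemma solved_mul bl n E W : n < size (entries bl) -> solved (entries bl) n E W ->
  let m := ('X - (nth (x0 F) (entries bl) n).1.1.1%:P)%R in
  solved (entries bl) n.+1 (m * E)%R (m * W)%R.
Proof. by move=> hn h m j hj; apply: val_mul_zero. Qed.

Lemma solvedS ents n E W : solved ents n E W ->
  entry_val (nth (x0 F) ents n) E W = 0%R -> solved ents n.+1 E W.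
Proof.
move=> h h0 j; rewrite ltnS leq_eqVlt => /orP[/eqP -> //|]; exact: h.
Qed.

Lemma kloop_ok M bl e n L X Y C3 C4 N R Q :
  let ents := entries bl in
  Y = X + L -> C3 = Y + L -> C4 = C3 + L -> L = size ents -> n <= L -> L <= M -> 9 <= X ->
  N 1 = 1 -> N 5 = X -> N 6 = Y -> N 7 = e -> N 8 = 0 -> N 9 = C3 -> N 10 = C4 ->
  N 11 = L -> N 12 = 0 -> N 13 = n ->
  rep ents R X 1 0 -> rep ents R Y 0 1 -> tables ents R C3 C4 ->
  (forall N' R' d1 w2 E1 W1 E2 W2, agree [:: 7; 8; 12; 13; 14; 15; 16] N N' ->
    N' 7 = e + d1 -> d1 + w2 = n -> good e d1 w2 E1 W1 E2 W2 ->
    rep ents R' X E1 W1 -> solved ents n E1 W1 -> solved ents n E2 W2 -> Q N' R') ->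
  tr M kloop N R Q.
Proof.
move=> ents dY dC3 dC4 Ls nL LM X9 n1 n5 n6 n7 n8 n9 n10 n11 n12 n13 repX repY tab hQ.
apply: (@tr_while _ _ _ _ _ _ (fun m N' R' => m <= n /\ N' 13 = m /\
  agree [:: 7; 8; 12; 13; 14; 15; 16] N N' /\ N' 12 = n - m /\ tables ents R' C3 C4 /\
  exists d1 w2 E1 W1 E2 W2, [/\ N' 7 = e + d1, N' 8 = w2, d1 + w2 = n - m &
    good e d1 w2 E1 W1 E2 W2] /\
    [/\ rep ents R' X E1 W1, rep ents R' Y E2 W2,
       solved ents (n - m) E1 W1 & solved ents (n - m) E2 W2]) n) => //.
- lia.
- split=> //; split=> //; split=> //; split; first lia; split=> //.
  exists 0, 0, 1%R, 0%R, 0%R, 1%R; rewrite subnn; split; last by [].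
  by split; rewrite ?addn0 //; apply: good0.
- by move=> m N' R' [_ [->]].
- move=> m N1 R1 hm [_ [h13 [ag [h12 [tab1 [d1 [w2 [E1 [W1 [E2 [W2 [[h7 h8 hd gd]
    [repX1 repY1 sol1 sol2]]]]]]]]]]]]].
  have [m1 m9 m10 m11] : [/\ N1 1 = 1, N1 9 = C3, N1 10 = C4 & N1 11 = L].
    by rewrite !ag.
  have [m5 m6] : N1 5 = X /\ N1 6 = Y by rewrite !ag.
  set i := n - m.+1 in h12 hd sol1 sol2.
  have iL : i < L by lia.
  have iS : n - m = i.+1 by lia.
  have iL' : i < size ents by rewrite -Ls.
  apply: tr_seq; exec.
  set N2 := upd _ _ _; set R2 := upd _ _ _.
  have fr2 x : 7 < x -> R2 x = R1 x by move=> x7; rewrite /R2; rd; dif.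
  have ag2 : agree [:: 13; 14; 16] N1 N2 by rewrite /N2; agr0.
  have tab2 : tables ents R2 C3 C4.
    by move=> j hj; have [<- <-] := tab1 j hj; split; rewrite fr2 //; lia.
  have repX2 : rep ents R2 X E1 W1 by move=> j hj; rewrite fr2 ?repX1 //; lia.
  have repY2 : rep ents R2 Y E2 W2 by move=> j hj; rewrite fr2 ?repY1 //; lia.
  have r24 : R2 4 = (nth (x0 F) ents i).1.1.1.
    by rewrite /R2; rd; rewrite m9 h12; have [] := tab1 i iL'.
  have n213 : N2 13 = m by rewrite /N2; rd; rewrite h13 m1 subn1.
  have n216 : N2 16 = w2 - (e + d1) by rewrite /N2; rd; rewrite h8 h7.
  have {m1 m5 m6 m9 m10} [m1 m5 m6 m9 m10] :
    [/\ N2 1 = 1, N2 5 = X, N2 6 = Y, N2 9 = C3 & N2 10 = C4] by rewrite !ag2.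
  have {m11 h7 h8 h12} [m11 m12 m7 m8] : [/\ N2 11 = L, N2 12 = i, N2 7 = e + d1 & N2 8 = w2].
    by rewrite !ag2.
  apply: tr_seq; apply: tr_ifnz; rewrite n216 subn_eq0 -ltnNge.
  (* Four outcomes, given by the choice of pivot and of the multiplied pair, end with the same
     bookkeeping. *)
  have fin N3 R3 w d1' w2' E1' W1' E2' W2' : agree [:: 14; 15; w] N2 N3 -> w \in [:: 7; 8] ->
     N3 7 = e + d1' -> N3 8 = w2' -> d1' + w2' = i.+1 ->
     (forall x, 7 < x -> (x < X) || (X + L <= x) -> (x < Y) || (Y + L <= x) -> R3 x = R2 x) ->
     good e d1' w2' E1' W1' E2' W2' -> rep ents R3 X E1' W1' -> rep ents R3 Y E2' W2' ->
     solved ents i.+1 E1' W1' -> solved ents i.+1 E2' W2' ->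
     tr M (Blk [:: NAdd 12 12 1]) N3 R3 (fun N' R' => m <= n /\ N' 13 = m /\
  agree [:: 7; 8; 12; 13; 14; 15; 16] N N' /\ N' 12 = n - m /\ tables ents R' C3 C4 /\
  exists d1 w2 E1 W1 E2 W2, [/\ N' 7 = e + d1, N' 8 = w2, d1 + w2 = n - m &
    good e d1 w2 E1 W1 E2 W2] /\
    [/\ rep ents R' X E1 W1, rep ents R' Y E2 W2,
       solved ents (n - m) E1 W1 & solved ents (n - m) E2 W2]).
    move=> ag3 hw h37 h38 hd' fr3 gd' rX rY s1 s2; exec.
    move: hw; rewrite !inE => hw.
    have ag3' r : r != 7 -> r != 8 -> r != 14 -> r != 15 -> N3 r = N2 r.
      by move=> *; apply: ag3; rewrite !inE; lia.
    split; first lia.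
    split; first by rd; rewrite ag3'.
    split.
      move=> r; rewrite !inE => hr; rd; dif; rewrite ag3'; try lia.
      by rewrite ag2 ?ag // !inE; lia.
    split; first by rd; rewrite !ag3' // m12 m1 iS addn1.
    split; first by move=> j hj; have [<- <-] := tab2 j hj; split; rewrite fr3 //; lia.
    by exists d1', w2', E1', W1', E2', W2'; rewrite iS; split.
  case: ifP => hw.
    apply: (@elim_ok _ _ 5 6 7 8 bl i _ _ L X Y C3 C4 E1 W1 E2 W2) => //; try lia.
    move=> N3 R3 c w b ag3 hNw wb fr3 E' W' mm.
    have gd' : good e d1 w2 E1 W1 E' W' by apply: good_add2.
    have sol' : solved ents i E' W' by apply: solved_add.
    case: b wb => wb [v0 [r1 r2]]; rewrite wb in hNw ag3; have ag3' := ag3.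
      apply: (fin N3 R3 8 d1 w2.+1 E1 W1) ag3 _ _ _ _ fr3 (good_mul2 _ gd') r1 r2 _ _ => //.
      - by rewrite ag3'.
      - by rewrite hNw m8.
      - by rewrite addnS hd.
      - exact: solvedS.
      - exact: solved_mul.
    apply: (fin N3 R3 7 d1.+1 w2) ag3 _ _ _ _ fr3 (good_mul1 _ gd') r1 r2 _ _ => //.
    - by rewrite hNw m7 addnS.
    - by rewrite ag3'.
    - by rewrite addSn hd.
    - exact: solved_mul.
    - exact: solvedS.
  apply: (@elim_ok _ _ 6 5 8 7 bl i _ _ L Y X C3 C4 E2 W2 E1 W1) => //; try lia.
  move=> N3 R3 c w b ag3 hNw wb fr3 E' W' mm.
  have gd' : good e d1 w2 E' W' E2 W2 by apply: good_add1; rewrite // leqNgt hw.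
  have sol' : solved ents i E' W' by apply: solved_add.
  have fr3' x : 7 < x -> (x < X) || (X + L <= x) -> (x < Y) || (Y + L <= x) -> R3 x = R2 x.
    by move=> *; apply: fr3.
  case: b wb => wb [v0 [r1 r2]]; rewrite wb in hNw ag3; have ag3' := ag3.
    apply: (fin N3 R3 7 d1.+1 w2) ag3 _ _ _ _ fr3' (good_mul1 _ gd') r2 r1 _ _ => //.
    - by rewrite hNw m7 addnS.
    - by rewrite ag3'.
    - by rewrite addSn hd.
    - exact: solved_mul.
    - exact: solvedS.
  apply: (fin N3 R3 8 d1 w2.+1) ag3 _ _ _ _ fr3' (good_mul2 _ gd') r2 r1 _ _ => //.
  - by rewrite ag3'.
  - by rewrite hNw m8.
  - by rewrite addnS hd.
  - exact: solvedS.
  - exact: solved_mul.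
- move=> N' R' [_ [_ [ag [_ [_ [d1 [w2 [E1 [W1 [E2 [W2 [[h7 h8 hd gd] [r1 r2 s1 s2]]]]]]]]]]]]].
  by rewrite subn0 in hd s1 s2; apply: (hQ _ _ d1 w2 E1 W1 E2 W2).
Qed.
End MainLoop.

(** * Division of [W1] by [E1], test of the remainder, output *)

Definition divloop : cmd :=
  Seq (Blk [:: NSub 20 7 4; NAdd 8 5 3; NAdd 22 8 17; NAdd 14 8 20; FLoad 6 14;
               FInv 6 6; NAdd 13 4 1])
    (While 13 (Seq (Blk [:: NSub 13 13 1; NAdd 12 22 13; NAdd 14 12 20; FLoad 3 14;
                            FMul 3 3 6; FOpp 3 3; NAdd 14 6 13; FStore 14 3; NAdd 15 20 1])
                   (axpy 8 12))).

Definition zerotest : cmd :=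
  Seq (Blk [:: NConst 0 1; NConst 14 0; NAdd 15 17 14; FZero 5])
    (While 15 (Seq (Blk [:: NSub 15 15 1; NAdd 14 22 15; FLoad 0 14])
                   (IfEq 0 5 (Blk [::]) (Blk [:: NConst 0 0])))).

(** Going downwards, the transfer register [Fr0] is overwritten last, with its own final value. *)
Definition copyout : cmd :=
  Seq (Blk [:: NAdd 13 4 1])
    (While 13 (Blk [:: NSub 13 13 1; NAdd 14 6 13; FLoad 0 14; FStore 13 0])).

Definition finish : cmd :=
  Seq (Blk [:: NAdd 14 7 7; NSub 14 14 4; NSub 16 3 14; NConst 0 0])
    (IfNZ 16 (Seq divloop (Seq zerotest copyout)) (Blk [::])).

Section Output.
Context (F : fieldType).
Implicit Types (N : nat -> nat) (R : nat -> F) (p q P S E W : {poly F}).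

Lemma coef_mul_top p q d i : (forall k, d < k -> (p`_k = 0)%R) ->
  (forall k, i < k -> (q`_k = 0)%R) -> ((p * q)`_(d + i)%N = p`_d * q`_i)%R.
Proof.
move=> hp hq; have hd : d < (d + i).+1 by lia.
rewrite coefM (bigD1 (Ordinal hd)) //= addKn big1 ?addr0 // => -[k hk].
rewrite -val_eqE /= => ne; have [lt_k|ge_k] := ltnP k d.
  by rewrite hq ?mulr0 //; lia.
by rewrite hp ?mul0r //; lia.
Qed.

Lemma copyout_ok M e N R (Y : nat) Q :
  e.+1 <= M -> e < Y -> N 1 = 1 -> N 4 = e -> N 6 = Y ->
  (forall N' R', N' 0 = N 0 -> (forall k, k <= e -> R' k = R (Y + k)) -> Q N' R') ->
  tr M copyout N R Q.
Proof.
move=> eM eY n1 n4 n6 hQ; apply: tr_seq; exec; rewrite n4 n1 addn1.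
apply: (@tr_while _ _ _ _ _ _ (fun m N' R' => [/\ m <= e.+1, N' 13 = m,
  agree [:: 13; 14] N N', forall x, Y <= x -> R' x = R x &
  forall k, m <= k <= e -> R' k = R (Y + k)]) e.+1) => //.
- split=> //; first by agr0.
  by move=> k; lia.
- by move=> m N' R' [_ ->].
- move=> m N1 R1 hm [_ h13 ag hR hk]; exec.
  have m1 : N1 1 = 1 by rewrite ag.
  have m6 : N1 6 = Y by rewrite ag.
  rewrite h13 m1 m6 subn1 /=.
  split=> //; first lia.
  + by agr ag.
  + by move=> x hx; rd; dif; apply: hR.
  + move=> k hmk; rd; case: eqP => [->|ne]; first by rewrite hR //; lia.
    dif; apply: hk; lia.
- move=> N' R' [_ _ ag _ hk]; apply: hQ; first by rewrite ag.
  by move=> k ke; apply: hk.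
Qed.

Lemma zerotest_ok M N R n2 V Q :
  n2 <= M -> 8 <= V -> N 1 = 1 -> N 17 = n2 -> N 22 = V ->
  (forall N' R', agree [:: 0; 14; 15] N N' -> (forall x, 7 < x -> R' x = R x) ->
     (N' 0 != 0) = [forall j : 'I_n2, R (V + j) == 0%R] -> Q N' R') ->
  tr M zerotest N R Q.
Proof.
move=> nM V8 n1 n17 n22 hQ; apply: tr_seq; exec; rewrite n17 addn0.
apply: (@tr_while _ _ _ _ _ _ (fun m N' R' => [/\ m <= n2, N' 15 = m,
  agree [:: 0; 14; 15] N N', R' 5 = 0%R & (forall x, 7 < x -> R' x = R x) /\
  (N' 0 != 0) = [forall j : 'I_n2, (m <= j) ==> (R (V + j) == 0%R)]]) n2) => //.
- split=> //; first by agr0.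
  split; first by move=> x x7; rd; dif.
  by rd; symmetry; apply/forallP => j; rewrite leqNgt ltn_ord.
- by move=> m N' R' [_ ->].
- move=> m N1 R1 hm [_ h15 ag h5 [hR h0]].
  have m1 : N1 1 = 1 by rewrite ag.
  have m22 : N1 22 = V by rewrite ag.
  have spl : [forall j : 'I_n2, (m <= j) ==> (R (V + j) == 0%R)] =
     (R (V + m) == 0%R) && [forall j : 'I_n2, (m < j) ==> (R (V + j) == 0%R)].
    apply/forallP/andP => [H|[H0 /forallP H] j].
      split; first by have := H (Ordinal hm); rewrite /= leqnn.
      by apply/forallP => j; apply/implyP => mj; apply: (implyP (H j)); apply: ltnW.
    by apply/implyP; rewrite leq_eqVlt => /orP[/eqP <- //|]; apply/implyP/H.
  apply: tr_seq; exec; rewrite h15 m1 m22 subn1 /= hR; last lia.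
  apply: tr_ifeq; rd; rewrite h5; case: ifP => hv; exec.
  + split=> //; first lia.
    * by agr ag.
    * split; first by move=> x x7; rd; dif; apply: hR.
      by rd; rewrite h0 spl hv.
  + split=> //; first lia.
    * by agr ag.
    * split; first by move=> x x7; rd; dif; apply: hR.
      by rd; rewrite spl hv.
- by move=> N' R' [_ _ ag _ [hR h0]]; apply: hQ.
Qed.

(** Long division producing only the [e + 1] low quotient coefficients, written over the array of
    the second pair. As the cells hold [- W], multiples of [E] are added and the cells end up with
    [E * P - W]. An exact quotient of size at most [e + 1] has to be [P]. *)
Lemma divloop_ok M N R e d n B X Eb V Y E W Q :
  B = n + n -> Eb = X + n -> V = Eb + B ->
  e.+1 <= M -> d.+1 <= M -> 9 <= X -> V + B <= Y -> e + d < B ->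
  N 1 = 1 -> N 3 = n -> N 4 = e -> N 5 = X -> N 6 = Y -> N 7 = e + d -> N 17 = B ->
  (forall k, k < B -> R (Eb + k) = (E`_k)%R) -> (forall k, k < B -> R (V + k) = (- W`_k)%R) ->
  (E`_d != 0)%R -> (forall k, d < k -> (E`_k = 0)%R) ->
  (forall N' R' P, agree [:: 8; 12; 13; 14; 15; 20; 22] N N' -> N' 22 = V ->
     size P <= e.+1 -> (forall k, k <= e -> R' (Y + k) = (P`_k)%R) ->
     (forall k, k < B -> R' (V + k) = ((E * P - W)`_k)%R) ->
     (forall S, size S <= e.+1 -> W = (E * S)%R -> P = S) -> Q N' R') ->
  tr M divloop N R Q.
Proof.
move=> dB dEb dV eM dM X9 VY edB n1 n3 n4 n5 n6 n7 n17 hE hV Ed Eh hQ.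
apply: tr_seq; exec; rewrite n7 n4 n1 n5 n3 n17 addKn addn1 -dEb -dV.
(* With [m] coefficients still to be found, [P] is the partial quotient; every exact quotient [S] of
   admissible size agrees with it from index [m] on. *)
apply: (@tr_while _ _ _ _ _ _ (fun m N' R' => [/\ m <= e.+1, N' 13 = m,
  agree [:: 8; 12; 13; 14; 15; 20; 22] N N', N' 8 = Eb & N' 20 = d] /\ N' 22 = V /\
  R' 6 = (E`_d)^-1%R /\ (forall k, k < B -> R' (Eb + k) = (E`_k)%R) /\ exists P,
   [/\ forall k, (k < m) || (e < k) -> (P`_k = 0)%R,
    forall k, m <= k <= e -> R' (Y + k) = (P`_k)%R,
    forall k, k < B -> R' (V + k) = ((E * P - W)`_k)%R &
    forall S, size S <= e.+1 -> W = (E * S)%R -> forall k, m <= k -> (P`_k = S`_k)%R]) e.+1) => //.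
- split; first by split=> //; agr0.
  split=> //; split; first by rd; rewrite hE //; lia.
  split; first by move=> k hk; rd; dif; rewrite hE.
  exists 0%R; split=> [k _|k|k hk|S sS _ k hk].
  + by rewrite coef0.
  + lia.
  + by rd; dif; rewrite hV // mulr0 sub0r coefN.
  + by rewrite coef0 nth_default //; apply: leq_trans sS hk.
- by move=> m N' R' [[_ ->]].
- move=> m N1 R1 hm [[_ h13 ag h8 h20] [h22 [h6 [hE1 [P [P0 PY PV PS]]]]]].
  have m1 : N1 1 = 1 by rewrite ag.
  have m6 : N1 6 = Y by rewrite ag.
  apply: tr_seq; exec; rewrite h13 m1 m6 h20 h22 h6 subn1 /= addn1.
  set N2 := upd _ _ _; set R2 := upd _ _ _.
  pose r : F := (- (R1 (V + m + d)%N / E`_d))%R.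
  have ag2 : agree [:: 12; 13; 14; 15] N1 N2 by rewrite /N2; agr0.
  have hR2 x : 7 < x -> R2 x = if x == Y + m then r else R1 x.
    by move=> x7; rewrite /R2; rd; dif.
  have r23 : R2 3 = r by rewrite /R2; rd; dif.
  have r26 : R2 6 = (E`_d)^-1%R by rewrite /R2; rd; dif.
  have n215 : N2 15 = d.+1 by rewrite /N2; rd.
  have n212 : N2 12 = V + m by rewrite /N2; rd.
  have n213 : N2 13 = m by rewrite /N2; rd.
  have [n21 n28 n220 n222] : [/\ N2 1 = 1, N2 8 = Eb, N2 20 = d & N2 22 = V].
    by rewrite !ag2.
  apply: (@axpy_ok _ _ _ _ _ _ d.+1 Eb (V + m)) => //; try lia.
  move=> N3 R3 ag3 hR3.
  have hR3' x : 7 < x -> R3 x = (if V + m <= x < V + m + d.+1 then (R2 x + R2 (x - (V + m) + Eb)%N * r)%R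
      else R2 x) by move=> x7; rewrite hR3 ?r23 //; lia.
  split.
    split; rewrite ?ag3 //; first lia.
    by move=> r' hr'; move: (hr'); rewrite !inE => ?; rewrite ag3 ?ag2 ?ag // !inE; lia.
  split; first by rewrite ag3.
  split; first by rewrite hR3 //; dif.
  split.
    by move=> k hk; rewrite hR3'; [dif; rewrite hR2; [dif; exact: hE1 | lia] | lia].
  exists (P + r *: 'X^m)%R; split.
  + move=> k hk; rewrite coefD coefZ coefXn P0; last lia.
    have -> : (k == m) = false by lia.
    by rewrite mulr0 addr0.
  + move=> k hk; rewrite hR3'; last lia.
    dif; rewrite hR2; last lia.
    rewrite coefD coefZ coefXn eqn_add2l; case: eqP => [->|ne] /=.
      by rewrite P0 ?add0r ?mulr1 //; lia.
    by rewrite mulr0 addr0 PY //; lia.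
  + move=> k hk; rewrite hR3'; last lia.
    have coefk : ((E * (P + r *: 'X^m) - W)`_k =
        (E * P - W)`_k + r * (if (k < m)%N then 0 else E`_(k - m)%N))%R.
      rewrite mulrDr -scalerAr !coefB !coefD coefZ coefMXn.
      by rewrite addrAC.
    rewrite coefk hR2; last lia.
    dif; rewrite PV //.
    case: ifP => hk2.
      rewrite hR2; last lia.
      dif; have -> : V + k - (V + m) + Eb = Eb + (k - m) by lia.
      by rewrite hE1; [congr (_ + _)%R; exact: mulrC | lia].
    case: ifP => hkm; first by rewrite mulr0 addr0.
    by rewrite Eh ?mulr0 ?addr0 //; lia.
  + move=> S sS eW k hk.
    have PS' := PS S sS eW.
    rewrite coefD coefZ coefXn; case: eqP => [->|ne] /=; last first.
      by rewrite mulr0 addr0 PS' //; lia.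
    have -> : r = (S`_m)%R; last by rewrite P0 ?add0r ?mulr1 //; lia.
    rewrite /r -addnA PV; last lia.
    (* Here [E * P - W] is [E * (P - S)] and [P - S] vanishes above [m], so the coefficient of index
       [d + m] is [- E_d S_m], because [P] still has coefficient 0 at [m]. *)
    rewrite eW -mulrBr addnC (@coef_mul_top _ _ d m) //.
      rewrite coefB P0 ?sub0r ?ltnSn // mulrN mulNr opprK mulrAC divff //.
      by rewrite mul1r.
    by move=> l hl; rewrite coefB PS' ?subrr.
- move=> N' R' [[_ _ ag h8 h20] [h22 [h6 [_ [P [P0 PY PV PS]]]]]].
  apply: (hQ _ _ P) => //.
  + by apply/leq_sizeP => k hk; rewrite P0 // hk orbT.
  + by move=> S sS eW; apply/polyP => k; apply: PS.
Qed.

Lemma finish_ok M N R e d n B X Eb V Y E W Q :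
  B = n + n -> Eb = X + n -> V = Eb + B ->
  B <= M -> e < n -> 9 <= X -> V + B <= Y -> e + d < B ->
  N 1 = 1 -> N 3 = n -> N 4 = e -> N 5 = X -> N 6 = Y -> N 7 = e + d -> N 17 = B ->
  (forall k, k < B -> R (Eb + k) = (E`_k)%R) -> (forall k, k < B -> R (V + k) = (- W`_k)%R) ->
  (E`_d != 0)%R -> (forall k, d < k -> (E`_k = 0)%R) -> (forall k, e + d < k -> (W`_k = 0)%R) ->
  (forall N' R', N' 0 = 0 ->
     (2 * d + e < n -> forall S, size S <= e.+1 -> W <> (E * S)%R) -> Q N' R') ->
  (forall N' R' P, N' 0 != 0 -> 2 * d + e < n -> size P <= e.+1 -> W = (E * P)%R ->
     (forall k, k <= e -> R' k = (P`_k)%R) -> Q N' R') ->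
  tr M finish N R Q.
Proof.
move=> dB dEb dV BM en X9 VY edB n1 n3 n4 n5 n6 n7 n17 hE hV Ed Eh Wh hQ0 hQ1.
apply: tr_seq; exec; rewrite n7 n4 n3.
apply: tr_ifnz; rd.
set N1 := upd _ _ _.
have ag1 : agree [:: 0; 14; 16] N N1 by rewrite /N1; agr0.
case: ifP => hd; last first.
  by exec; apply: hQ0 => [|h2]; [rewrite /N1; rd | exfalso; lia].
apply: tr_seq; apply: (@divloop_ok _ _ _ e d n B X Eb V Y E W) => //; rewrite ?ag1 //; try lia.
move=> N2 R2 P ag2 h22 sP PY PV PS.
have [m1 m17 m4 m6] : [/\ N2 1 = 1, N2 17 = B, N2 4 = e & N2 6 = Y].
  by rewrite !ag2 // !ag1.
apply: tr_seq; apply: (@zerotest_ok _ _ _ B V) => //; first lia.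
move=> N3 R3 ag3 hR3 h0.
have [l1 l4 l6] : [/\ N3 1 = 1, N3 4 = e & N3 6 = Y] by rewrite !ag3.
apply: (@copyout_ok _ e _ _ Y) => //; try lia.
move=> N4 R4 h40 hR4; case: (boolP (N3 0 == 0)) => z.
  apply: hQ0 => [|_ S sS eW]; first by rewrite h40; apply/eqP.
  move: h0; rewrite z /= => /esym/negbT/forallPn[j]; apply/negP; rewrite negbK.
  by rewrite PV // (PS S sS eW) -eW subrr coef0.
apply: (hQ1 _ _ P); rewrite ?h40 //; first lia.
  apply/esym/eqP; rewrite -subr_eq0; apply/eqP/polyP => k; rewrite coef0.
  (* The test reads the coefficients below [B]; beyond, both [W] and [E * P] vanish since their
     degrees are at most [e + d < B]. *)
  have [kB|Bk] := ltnP k B.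
    by move: h0; rewrite z => /esym/forallP/(_ (Ordinal kB))/eqP /=; rewrite PV.
  rewrite coefB Wh; last lia.
  rewrite subr0 coefM big1 // => -[i hi] _ /=.
  have [di|id] := ltnP d i; first by rewrite Eh // mul0r.
  by rewrite [X in (_ * X)%R]nth_default ?mulr0 //; apply: leq_trans sP _; lia.
by move=> k ke; rewrite hR4 // hR3 ?PY //; lia.
Qed.
End Output.

(** * Memory layout and initial arrays *)

(** Unrolled because a copying loop needs a scratch field register, and all low ones may still hold
    input. *)
Fixpoint fsaves (i k : nat) : cmd :=
  if k is k'.+1 then Seq (Blk [:: FStore 14 i; NAdd 14 14 1]) (fsaves i.+1 k') else Blk [::].

(** Moves are additions of a register holding 0. The offset 9 keeps the arrays, and the cell before
    them, off the scratch registers. Each array has [5n] cells: [n] residuals and [2n] coefficients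
    for each of [E] and [- W]. The first array starts where the copied coefficients of [h] do, since
    these are the residuals of the pair (1, 0). *)
Definition layout : cmd :=
  Blk [:: NAdd 17 3 3; NAdd 11 17 17; NAdd 11 11 3; NConst 14 9; NAdd 19 2 3;
     NAdd 15 19 14; NAdd 5 15 2; NAdd 6 5 11; NAdd 9 6 11; NAdd 10 9 11; NConst 16 0;
     NAdd 14 15 16; NConst 16 8; NAdd 20 15 16; NSub 15 19 16; NAdd 19 14 21].

Definition copyin : cmd :=
  Seq (Seq (Blk [:: NConst 21 0]) layout) (Seq (fsaves 0 8)
  (While 15 (Blk [:: NSub 15 15 1; NAdd 14 16 15; FLoad 0 14; NAdd 14 20 15; FStore 14 0]))).

(** [Fr3] is 0 on the first cell of a block and 1 afterwards, so [Fr3 - 1] lists the coefficients of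
    the constant -1, the value of the pair (0, 1) on the residual and [- W] blocks. *)
Definition fillblk : cmd :=
  Seq (Blk [:: FZero 3])
    (While 15 (Blk [:: NSub 15 15 1; NAdd 14 9 12; FStore 14 4; NAdd 14 10 12; FStore 14 3;
       FOne 0; FOpp 1 0; FAdd 1 3 1; NAdd 14 6 12; FStore 14 1; FOne 3; NAdd 12 12 1])).

(** The last block sets the constant coefficient of [E1] to 1 and that of [E2] to 0, the latter
    because [fillblk] has written -1 there. It also initialises the degrees and the counters. *)
Definition fill : cmd :=
  Seq (Blk [:: NConst 12 0; NAdd 13 2 12; NAdd 20 19 12; NAdd 21 18 12])
  (Seq (While 13 (Seq (Blk [:: NSub 13 13 1; FLoad 4 20; NLoad 15 21; NAdd 20 20 1;
                               NAdd 21 21 1]) fillblk))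
  (Seq (Blk [:: FZero 4; NConst 14 0; NAdd 15 17 14])
  (Seq fillblk
  (Seq (Blk [:: NConst 14 0; NAdd 15 17 14])
  (Seq fillblk
       (Blk [:: NAdd 14 5 3; FOne 0; FStore 14 0; NAdd 14 6 3; FZero 0; FStore 14 0;
          NConst 14 0; NAdd 7 4 14; NConst 8 0; NConst 12 0; NAdd 13 3 14])))))).

Section Input.
Context (F : fieldType).
Implicit Types (N : nat -> nat) (R : nat -> F).

Lemma fsaves_ok M i k D N R Q : i + k <= D -> N 14 = D + i -> N 1 = 1 ->
  (forall N' R', agree [:: 14] N N' ->
     (forall x, R' x = if D + i <= x < D + i + k then R (x - D) else R x) -> Q N' R') ->
  tr M (fsaves i k) N R Q.
Proof.
elim: k i N R Q => [|k IH] i N R Q ik n14 n1 hQ.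
  by apply: tr_nil; apply: hQ => // x; dif.
apply: tr_seq; exec; rewrite n14 n1; apply: IH => //; [lia | by rd; lia | ].
move=> N' R' ag hR; apply: hQ; first by move=> r hr; rewrite ag //; move: hr; rewrite inE => ?; rd; dif.
move=> x; rewrite hR; case: ifP => h; first by rd; dif.
by rd; case: eqP => [->|ne]; dif; [congr R; lia|].
Qed.

Lemma copyin_ok M N R t n Q : t + n <= M -> N 1 = 1 -> N 2 = t -> N 3 = n ->
  (forall k, t + n <= k -> R k = 0%R) ->
  (forall N' R', agree [:: 5; 6; 9; 10; 11; 14; 15; 16; 17; 19; 20; 21] N N' ->
     N' 17 = n + n -> N' 11 = 5 * n -> N' 19 = t + n + 9 -> N' 5 = t + n + 9 + t ->
     N' 6 = N' 5 + 5 * n -> N' 9 = N' 6 + 5 * n -> N' 10 = N' 9 + 5 * n ->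
     (forall k, R' (t + n + 9 + k) = R k) -> Q N' R') ->
  tr M copyin N R Q.
Proof.
move=> tM n1 n2 n3 R0 hQ.
apply: tr_seq; apply: tr_seq; exec; exec; rewrite n2 n3 !addn0.
set N1 := upd _ _ _.
have ag1 : agree [:: 5; 6; 9; 10; 11; 14; 15; 16; 17; 19; 20; 21] N N1 by rewrite /N1; agr0.
have [h17 h11 h19 h5] : [/\ N1 17 = n + n, N1 11 = 5 * n, N1 19 = t + n + 9 & N1 5 = t + n + 9 + t].
  by rewrite /N1; split=> //; rd; lia.
have [h6 h9 h10] : [/\ N1 6 = N1 5 + 5 * n, N1 9 = N1 6 + 5 * n & N1 10 = N1 9 + 5 * n].
  by rewrite /N1; split=> //; rd; lia.
have [h15 h14 h16 h20] : [/\ N1 15 = t + n - 8, N1 14 = t + n + 9 + 0, N1 16 = 8 & N1 20 = t + n + 17].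
  by rewrite /N1; split=> //; rd; lia.
have h1 : N1 1 = 1 by rewrite ag1.
clearbody N1.
apply: tr_seq; apply: (@fsaves_ok _ _ _ (t + n + 9)) => //; first lia.
move=> N2 R2 ag2 hR1.
apply: (@tr_while _ _ _ _ _ _ (fun m N' R' => [/\ m <= t + n - 8, N' 15 = m,
  agree [:: 14; 15] N1 N' & forall x, 7 < x -> R' x =
    if (t + n + 9 <= x < t + n + 17) || (t + n + 17 + m <= x < t + n + 9 + (t + n))
    then R (x - (t + n + 9)) else R x]) (t + n - 8)) => //.
- lia.
- split=> //; first by rewrite ag2.
    by move=> r hr; rewrite ag2 //; move: hr; rewrite !inE; lia.
  by move=> x x7; rewrite hR1; congr (if _ then _ else _); lia.
- by move=> m N' R' [_ ->].
- move=> m N3 R3 hm [_ h3_15 ag hR]; exec; rewrite h3_15 !ag // h1 h16 h20 subn1 /=.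
  split=> //; first lia.
  + by agr ag.
  + move=> x x7; rd; case: eqP => [->|ne].
      rewrite hR; last lia.
      by dif; congr R; lia.
    dif; rewrite hR //; congr (if _ then _ else _); lia.
move=> N3 R3 [_ _ ag hR].
apply: hQ; rewrite ?ag //.
- by move=> r hr; rewrite ag ?ag1 //; move: hr; rewrite !inE; lia.
- move=> k; rewrite hR; last lia.
  have -> : t + n + 9 + k - (t + n + 9) = k by lia.
  by case: ifP => // h; rewrite !R0 //; lia.
Qed.

Lemma fillblk_ok M N R p l a Y C3 C4 L Q :
  l <= M -> 8 <= Y -> Y + L <= C3 -> C3 + L <= C4 -> p + l <= L ->
  N 1 = 1 -> N 6 = Y -> N 9 = C3 -> N 10 = C4 -> N 12 = p -> N 15 = l -> R 4 = a ->
  (forall N' R', agree [:: 12; 14; 15] N N' -> N' 12 = p + l -> R' 4 = a ->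
    (forall x, 7 < x -> R' x =
      if C3 + p <= x < C3 + p + l then a
      else if C4 + p <= x < C4 + p + l then (x - (C4 + p) != 0)%N%:R%R
      else if Y + p <= x < Y + p + l then ((x - (Y + p) != 0)%N%:R - 1)%R
      else R x) -> Q N' R') ->
  tr M fillblk N R Q.
Proof.
move=> lM Y8 YC3 C34 pL n1 n6 n9 n10 n12 n15 r4 hQ.
apply: tr_seq; exec.
apply: (@tr_while _ _ _ _ _ _ (fun m N' R' => [/\ m <= l, N' 15 = m,
  agree [:: 12; 14; 15] N N' & N' 12 = p + (l - m)] /\
  [/\ R' 4 = a, R' 3 = (l - m != 0)%N%:R%R & forall x, 7 < x -> R' x =
      if C3 + p <= x < C3 + p + (l - m) then a
      else if C4 + p <= x < C4 + p + (l - m) then (x - (C4 + p) != 0)%N%:R%R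
      else if Y + p <= x < Y + p + (l - m) then ((x - (Y + p) != 0)%N%:R - 1)%R
      else R x]) l) => //.
- rewrite subnn; split; first by split=> //; lia.
  by split=> // x x7; rd; dif.
- by move=> m N' R' [[_ ->]].
- move=> m N1 R1 hm [[_ h15 ag h12] [h4 h3 hR]]; exec.
  rewrite h15 h12 h4 h3 !ag // n1 n6 n9 n10 subn1 /=.
  split; first by split; [lia | by [] | by agr ag | rd; lia].
  split; first by rd; dif.
    by rd; dif; have -> : l - m != 0 by lia.
  move=> x x7; rd; dif.
  have ek Z : Z + (p + (l - m.+1)) - (Z + p) = l - m.+1 by lia.
  case: eqP => [->|neY]; first by dif; rewrite ek.
  case: eqP => [->|ne4]; first by dif; rewrite ek.
  case: eqP => [->|ne3].
    by dif.
  dif; rewrite hR //.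
  have -> : (C3 + p <= x < C3 + p + (l - m)) = (C3 + p <= x < C3 + p + (l - m.+1)) by lia.
  have -> : (C4 + p <= x < C4 + p + (l - m)) = (C4 + p <= x < C4 + p + (l - m.+1)) by lia.
  by have -> : (Y + p <= x < Y + p + (l - m)) = (Y + p <= x < Y + p + (l - m.+1)) by lia.
- move=> N' R' [[_ _ ag h12] [h4 _ hR]]; rewrite subn0 in h12 hR; exact: hQ.
Qed.

Definition filled (bs : seq (block F * nat)) R Y C3 C4 :=
  forall j, j < size (entries bs) -> let x := nth (x0 F) (entries bs) j in
    [/\ R (C3 + j) = x.1.1.1, R (C4 + j) = (x.2 != 0)%:R%R & R (Y + j) = ((x.2 != 0)%:R - 1)%R].

Lemma fillblk_filled M N R bs (b : block F) l Y C3 C4 L Q :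
  let p := size (entries bs) in
  l <= M -> 8 <= Y -> Y + L <= C3 -> C3 + L <= C4 -> p + l <= L ->
  N 1 = 1 -> N 6 = Y -> N 9 = C3 -> N 10 = C4 -> N 12 = p -> N 15 = l -> R 4 = b.1.1 ->
  filled bs R Y C3 C4 ->
  (forall N' R', agree [:: 12; 14; 15] N N' ->
    N' 12 = size (entries (rcons bs (b, l))) -> R' 4 = b.1.1 ->
    filled (rcons bs (b, l)) R' Y C3 C4 ->
    (forall x, 7 < x < Y -> R' x = R x) -> Q N' R') ->
  tr M fillblk N R Q.
Proof.
move=> p lM Y8 YC3 C34 pL n1 n6 n9 n10 n12 n15 r4 fil hQ.
apply: (@fillblk_ok _ _ _ p l b.1.1 Y C3 C4 L) => // N' R' ag h12 h4 hR.
have ent : entries (rcons bs (b, l)) = entries bs ++ [seq (b, j) | j <- iota 0 l].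
  by rewrite -cats1 entries_cat entries_cons /= cats0.
have sz : size (entries (rcons bs (b, l))) = p + l.
  by rewrite ent size_cat size_map size_iota.
apply: hQ => //; first by rewrite sz.
  move=> j hj /=; rewrite sz in hj; rewrite ent nth_cat -/p.
  case: ifP => jp.
    have [f3 f4 fY] := fil j jp; rewrite !hR; try lia.
    by dif; split.
  have e1 : nth (x0 F) [seq (b, i) | i <- iota 0 l] (j - p) = (b, j - p).
    by rewrite (nth_map 0) ?size_iota ?nth_iota //; lia.
  rewrite e1 /= !hR; try lia.
  have ek Z : Z + j - (Z + p) = j - p by lia.
  by dif; rewrite !ek.
by move=> x hx; rewrite hR; [dif | lia].
Qed.

Lemma fill_ok M N R (T : seq F) (s : F -> nat) (h : F -> {poly F}) n L D X Y C3 C4 S Q :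
  let bl := blocks T s h (n + n) in let ents := entries bl in
  n = \sum_(a <- T) s a -> L = 5 * n -> X = D + size T -> Y = X + L -> C3 = Y + L ->
  C4 = C3 + L -> 0 < n -> L + size T <= M -> 9 <= D -> 32 < S ->
  N 1 = 1 -> N 2 = size T -> N 3 = n -> N 5 = X -> N 6 = Y -> N 9 = C3 -> N 10 = C4 ->
  N 11 = L -> N 17 = n + n -> N 18 = S -> N 19 = D ->
  (forall k, k < size T -> N (S + k) = s (nth 0%R T k)) ->
  (forall k, R (D + k) =
    nth 0%R (T ++ flatten [seq [seq ((h a)`_i)%R | i <- iota 0 (s a)] | a <- T]) k) ->
  (forall N' R', agree [:: 7; 8; 12; 13; 14; 15; 20; 21] N N' ->
    N' 7 = N 4 -> N' 8 = 0 -> N' 12 = 0 -> N' 13 = n ->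
    rep ents R' X 1 0 -> rep ents R' Y 0 1 -> tables ents R' C3 C4 -> Q N' R') ->
  tr M fill N R Q.
Proof.
move=> bl ents dn dL dX dY dC3 dC4 n0 LM D9 S32 n1 n2 n3 n5 n6 n9 n10 n11 n17 n18 n19 hS hR hQ.
have szT k : \sum_(a <- take k T) s a <= n.
  by rewrite dn -{2}(cat_take_drop k T) big_cat leq_addr.
apply: tr_seq; exec; rewrite n2 n18 n19 !addn0.
apply: tr_seq.
apply: (@tr_while _ _ _ _ _ _ (fun m N' R' => let k := size T - m in
  let bs := Tblocks (take k T) s h in
  [/\ m <= size T, N' 13 = m, agree [:: 12; 13; 14; 15; 20; 21] N N',
      N' 12 = size (entries bs) & N' 20 = D + k /\ N' 21 = S + k] /\
  filled bs R' Y C3 C4 /\ forall x, 7 < x < Y -> R' x = R x) (size T)) => //.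
- lia.
- rewrite /= subnn take0; split; first by split=> //; [agr0 | rewrite !addn0].
  by split.
- by move=> m N' R' [[_ ->]].
- move=> m N1 R1 hm /=.
  set k := size T - m.+1; have dk : size T - m = k.+1 by lia.
  have kT : k < size T by lia.
  rewrite dk (take_nth 0%R) // /Tblocks map_rcons -/(Tblocks _ s h).
  move=> [[_ h13 ag h12 [h20 h21]] [fil fr]].
  apply: tr_seq; exec; rewrite h13 h20 h21 (ag 1) // n1 subn1 /= (ag (S + k)) ?inE; last lia.
  rewrite hS // fr; last lia.
  rewrite hR nth_cat kT.
  set N2 := upd _ _ _; set R2 := upd _ _ _.
  have ag2 : agree [:: 13; 15; 20; 21] N1 N2 by rewrite /N2; agr0.
  have fr2 x : 7 < x -> R2 x = R1 x by move=> x7; rewrite /R2; rd; dif.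
  have sk : size (entries (Tblocks (take k T) s h)) + s (nth 0%R T k) <= n.
    rewrite size_Tentries; apply: leq_trans (szT k.+1).
    by rewrite (take_nth 0%R) // -cats1 big_cat big_seq1.
  have [a1 a6 a9 a10] : [/\ N2 1 = 1, N2 6 = Y, N2 9 = C3 & N2 10 = C4].
    by rewrite !ag2 // !ag.
  have a12 : N2 12 = size (entries (Tblocks (take k T) s h)) by rewrite ag2.
  have fil2 : filled (Tblocks (take k T) s h) R2 Y C3 C4.
    move=> j hj /=; have /= [<- <- <-] := fil j hj.
    by split; rewrite fr2 //; lia.
  apply: (@fillblk_filled _ _ _ (Tblocks (take k T) s h) (nth 0%R T k, h (nth 0%R T k), (-1)%R)
    (s (nth 0%R T k)) Y C3 C4 L) => //; try lia.
  + move=> N3 R3 ag3 h312 h34 fil3 fr3; split; last first.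
      by split=> // x hx; rewrite fr3 // fr2 ?fr //; lia.
    split=> //; first lia.
    * by rewrite ag3.
    * by move=> r; rewrite !inE => hr; rewrite ag3 ?ag2 ?ag ?inE //; lia.
    * by rewrite !ag3 // /N2; rd; split; lia.
move=> N1 R1 /=; rewrite subn0 take_size => -[[_ _ ag h12 _] [fil fr]].
apply: tr_seq; exec; rewrite (ag 17) // n17 addn0.
have szn : size (entries (Tblocks T s h)) = n by rewrite size_Tentries.
set N1' := upd _ _ _; set R1' := upd _ _ _.
have ag1' : agree [:: 14; 15] N1 N1' by rewrite /N1'; agr0.
have [a1 a6 a9 a10] : [/\ N1' 1 = 1, N1' 6 = Y, N1' 9 = C3 & N1' 10 = C4].
  by rewrite !ag1' // !ag.
have a12 : N1' 12 = size (entries (Tblocks T s h)) by rewrite ag1'.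
have fr1' x : 7 < x -> R1' x = R1 x by move=> hx; rewrite /R1'; rd; dif.
have fil1 : filled (Tblocks T s h) R1' Y C3 C4.
  move=> j hj /=; have /= [<- <- <-] := fil j hj; rewrite szn in hj.
  by split; rewrite fr1' //; lia.
apply: tr_seq; apply: (@fillblk_filled _ _ _ (Tblocks T s h) (0%R, 1%R, 0%R)
    (n + n) Y C3 C4 L) => //; rewrite ?szn; try lia.
move=> N2 R2 ag2 h212 h24 fil2 fr2.
have sz2 : size (entries (rcons (Tblocks T s h) ((0%R, 1%R, 0%R), n + n))) = n + (n + n).
  by rewrite -cats1 entries_cat size_cat szn size_entries big_cons big_nil /= addn0.
have {ag ag2}ag2 : agree [:: 12; 13; 14; 15; 20; 21] N N2.
  by move=> r; rewrite !inE => hr; rewrite ag2 ?inE ?ag1' ?inE ?ag ?inE //; lia.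
have {fr fr2}fr2 x : 7 < x < Y -> R2 x = R x.
  by move=> hx; rewrite fr2 // fr1' ?fr //; lia.
apply: tr_seq; exec; rewrite (ag2 17) // n17 addn0.
set N2' := upd _ _ _.
have ag2' : agree [:: 14; 15] N2 N2' by rewrite /N2'; agr0.
have {a1 a6 a9 a10 a12} [a1 a6 a9 a10] : [/\ N2' 1 = 1, N2' 6 = Y, N2' 9 = C3 & N2' 10 = C4].
  by rewrite !ag2' // !ag2.
have a12 : N2' 12 = size (entries (rcons (Tblocks T s h) ((0%R, 1%R, 0%R), n + n))) by rewrite ag2'.
apply: tr_seq; apply: (@fillblk_filled _ _ _
    (rcons (Tblocks T s h) ((0%R, 1%R, 0%R), n + n)) (0%R, 0%R, (-1)%R)
    (n + n) Y C3 C4 L) => //; rewrite ?sz2; try lia.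
move=> N3 R3 ag3 h312 h34 fil3 fr3.
have {ag2 ag3}ag3 : agree [:: 12; 13; 14; 15; 20; 21] N N3.
  by move=> r; rewrite !inE => hr; rewrite ag3 ?inE ?ag2' ?inE ?ag2 ?inE //; lia.
have {fr2 fr3}fr3 x : 7 < x < Y -> R3 x = R x by move=> hx; rewrite fr3 // fr2.
have dbl : rcons (rcons (Tblocks T s h) ((0%R, 1%R, 0%R), n + n)) ((0%R, 0%R, (-1)%R), n + n) = bl.
  by rewrite /bl /blocks -!cats1 -catA.
rewrite dbl in fil3 h312.
have szb : size ents = L by rewrite size_blocks -dn; lia.
exec; rewrite !(ag3 5, ag3 3, ag3 6, ag3 4) // n5 n3 n6.
apply: hQ => //.
- by agr ag3.
- by rd; rewrite addn0.
- by rd; rewrite addn0.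
(* Three ranges of cells: residuals, which are the copied coefficients of [h]; then [E1 = 1]; then
   [- W1 = 0]. The zeros come from the empty registers after the input. *)
- move=> j hj; rd; dif; rewrite val10.
  have [jn|nj] := ltnP j n.
    dif; rewrite fr3; last lia.
    have -> : X + j = D + (size T + j) by lia.
    rewrite hR nth_cat ltnNge leq_addr /= addKn /ents /bl nth_blocksT -?dn //.
    have := size_Tentries T s h; rewrite -dn => szT'.
    have -> : flatten [seq [seq ((h a)`_i)%R | i <- iota 0 (s a)] | a <- T] =
       map (fun x : block F * nat => (x.1.1.2`_x.2)%R) (entries (Tblocks T s h)).
      rewrite /entries map_flatten /Tblocks -!map_comp; congr flatten.
      by apply: eq_map => a /=; rewrite -map_comp.
    by rewrite (nth_map (x0 F)) ?szT'.
  have [lt_j|ge_j] := ltnP (j - n) (n + n).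
    have := nth_blocksE T s h lt_j; rewrite -dn subnKC // -/bl -/ents => -> /=.
    rewrite coef1; case: (eqVneq j n) => [->|ne]; first by rewrite eqxx subnn.
    dif; have -> : (j - n == 0) = false by lia.
    rewrite fr3; last lia.
    have -> : X + j = D + (size T + j) by lia.
    rewrite hR nth_default // size_cat.
    have -> : size (flatten [seq [seq ((h a)`_i)%R | i <- iota 0 (s a)] | a <- T]) = n.
      rewrite size_flatten /shape -map_comp dn sumnE big_map.
      by apply: eq_bigr => a _ /=; rewrite size_map size_iota.
    by rewrite leq_add2l.
  have lt2 : j - (n + (n + n)) < n + n by lia.
  have := nth_blocksW T s h lt2; rewrite -dn subnKC; last lia.
  rewrite -/bl -/ents => -> /=; rewrite coef0; dif.
  rewrite fr3; last lia.
  have -> : X + j = D + (size T + j) by lia.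
  rewrite hR nth_default // size_cat.
  have -> : size (flatten [seq [seq ((h a)`_i)%R | i <- iota 0 (s a)] | a <- T]) = n.
    rewrite size_flatten /shape -map_comp dn sumnE big_map.
    by apply: eq_bigr => a _ /=; rewrite size_map size_iota.
  by rewrite leq_add2l.
- move=> j hj; have /= [_ _ fY] := fil3 j hj; rd; rewrite eqn_add2l; dif; rewrite fY val01.
  have coefN1' i : ((-1 : {poly F})`_i = (i != 0%N)%:R - 1)%R.
    by rewrite coefN coef1; case: i => [|i] /=; rewrite ?sub0r ?subrr ?oppr0.
  have [jn|nj] := ltnP j n.
    dif; move: fY; rewrite /ents /bl nth_blocksT -?dn // => _.
    have : nth (x0 F) (entries (Tblocks T s h)) j \in entries (Tblocks T s h).
      by rewrite mem_nth // szn.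
    case/flattenP => l /mapP[b /mapP[a _ ->] ->] /mapP[i _ ->] /=.
    by rewrite coefN1'.
  have [lt_j|ge_j] := ltnP (j - n) (n + n).
    have := nth_blocksE T s h lt_j; rewrite -dn subnKC // -/bl -/ents => -> /=.
    rewrite coef0; case: eqP => // ne.
    have -> : (j - n != 0)%N by lia.
    by rewrite subrr.
  have lt2 : j - (n + (n + n)) < n + n by lia.
  have := nth_blocksW T s h lt2; rewrite -dn subnKC; last lia.
  by rewrite -/bl -/ents => -> /=; rewrite coefN1'; dif.
- move=> j hj; have /= [f3 f4 _] := fil3 j hj; split; rd; dif; [exact: f3|exact: f4].
Qed.
End Input.

(** * Relocation of the natural-number input *)

Fixpoint saves (i k : nat) : cmd :=
  if k is k'.+1 then Seq (Blk [:: NAdd 0 0 1; NStore 0 i]) (saves i.+1 k') else Blk [::].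

(* Every low register holds input at the start. [32n] is computed in place from the only
   register whose content stays recoverable; it exceeds all input addresses and all low
   registers, so the low registers can be saved from there on. *)
Definition relocate : cmd :=
  Seq (Blk [:: NAdd 0 0 0; NAdd 0 0 0; NAdd 0 0 0; NAdd 0 0 0; NAdd 0 0 0;
               NStore 0 1; NConst 1 1])
  (Seq (saves 2 30)
  (Seq (Blk [:: NConst 2 0; NConst 14 30; NSub 15 0 14; NConst 14 32])
  (Seq (While 15 (Blk [:: NSub 15 15 14; NAdd 2 2 1]))
  (Seq (Blk [:: NConst 14 29; NSub 18 0 14; NSub 14 18 1; NLoad 4 14; NConst 14 30;
                NSub 15 2 14; NConst 16 32; NAdd 17 0 1])
       (While 15 (Blk [:: NSub 15 15 1; NAdd 14 16 15; NLoad 20 14; NAdd 14 17 15;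
                          NStore 14 20])))))).

Definition sumup : cmd :=
  Seq (Blk [:: NConst 3 0; NConst 14 0; NAdd 15 2 14])
    (While 15 (Blk [:: NSub 15 15 1; NAdd 14 18 15; NLoad 16 14; NAdd 3 3 16])).

Section Relocation.
Context (F : fieldType).
Implicit Types (N : nat -> nat) (R : nat -> F).

Lemma saves_ok M i k c N R Q : 2 <= i -> i + k <= 32 -> 32 <= c -> N 0 = c + i - 2 -> N 1 = 1 ->
  (forall N', N' 0 = c + i + k - 2 ->
     (forall x, 0 < x -> N' x = if c + i - 1 <= x < c + i + k - 1 then N (x + 1 - c) else N x) ->
     Q N' R) ->
  tr M (saves i k) N R Q.
Proof.
elim: k i N Q => [|k IH] i N Q i2 ik c32 n0 n1 hQ.
  by apply: tr_nil; apply: hQ => [|x x0]; [lia | dif].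
apply: tr_seq; exec; rewrite n0 n1.
set N1 := upd _ _ _.
have hN1 x : 0 < x -> N1 x = if x == c + i - 1 then N i else N x.
  by move=> x0; rewrite /N1; rd; dif; congr (if _ then _ else _); lia.
apply: IH => //; try lia.
- by rewrite /N1; rd; dif; lia.
- by rewrite hN1 //; dif.
- move=> N' h0 hN'; apply: hQ; first lia.
  move=> x x0; rewrite hN' //; case: ifP => h1; rewrite hN1; try lia.
    by dif; rewrite /=.
  by case: eqP => [->|ne]; dif; first by congr N; lia.
Qed.

Lemma relocate_ok M N R n e Q : n.*2 <= M -> 0 < n -> N 0 = n -> N 1 = e ->
  (forall N', N' 1 = 1 -> N' 2 = n -> N' 4 = e -> 32 < N' 18 ->
     (forall k, k < n -> N' (N' 18 + k) = N k.+2) -> Q N' R) ->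
  tr M relocate N R Q.
Proof.
move=> nM n0 hn he hQ.
apply: tr_seq; exec; rewrite hn he.
set c := (X in upd _ 0 X); have dc : c = 32 * n by rewrite /c; lia.
move: c dc => c dc; set N1 := upd _ _ _.
have hN1 x : 1 < x -> N1 x = if x == c then e else N x.
  by move=> x1; rewrite /N1; rd; dif; congr (if _ then _ else _); lia.
apply: tr_seq; apply: (@saves_ok _ _ _ c) => //; try lia.
  by rewrite /N1; rd; dif; lia.
move=> N2 h20 hN2; have h21 : N2 1 = 1 by rewrite hN2 //; dif; rewrite /N1; rd; dif.
have {}hN2 x : 31 < x -> N2 x =
    if x == c then e else if c < x < c + 31 then N (x + 1 - c) else N x.
  move=> x31; rewrite hN2; last lia.
  case: ifP => h; first by rewrite hN1; [dif; dif | lia].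
  by rewrite hN1; last lia; case: ifP => // h'; dif.
apply: tr_seq; exec; rewrite h20.
(* Repeated subtraction of 32 from [32n] recovers [n]. *)
apply: tr_seq; apply: (@tr_while _ _ _ _ _ _ (fun m N' R' => [/\ m <= n, R' = R,
   N' 15 = 32 * m, N' 2 = n - m & N' 14 = 32 /\ agree [:: 2; 14; 15] N2 N']) n) => //.
- lia.
- split=> //; rd; try lia.
  by split=> //; agr0.
- by move=> m N' R' [_ _ -> _ _]; lia.
- move=> m N3 R3 hm [_ -> h15 h2 [h14 ag]]; exec; rewrite h15 h14 h2 (ag 1) // h21.
  split=> //; rd; try lia.
  by split=> //; agr ag.
move=> N3 R3 [_ -> _ h2 [_ ag]]; rewrite subn0 in h2.
have [h0 h1] : N3 0 = c + 30 /\ N3 1 = 1 by rewrite !ag // h20; lia.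
have {hN2}hN3 x : 31 < x -> N3 x =
    if x == c then e else if c < x < c + 31 then N (x + 1 - c) else N x.
  by move=> x31; rewrite ag ?hN2 // !inE; lia.
apply: tr_seq; exec; rewrite h0 h1 h2.
have -> : N3 (c + 30 - 29 - 1) = e by rewrite hN3; [dif | lia].
set N4 := upd _ _ _.
have ag4 : agree [:: 4; 14; 15; 16; 17; 18] N3 N4 by rewrite /N4; agr0.
have [h41 h42 h44 h418] : [/\ N4 1 = 1, N4 2 = n, N4 4 = e & N4 18 = c + 1].
  by rewrite /N4; split; rd; rewrite ?h1 ?h2; lia.
have [h415 h416 h417] : [/\ N4 15 = n - 30, N4 16 = 32 & N4 17 = c + 31].
  by rewrite /N4; split=> //; rd; lia.
(* The first 30 values of [s] were saved with the low registers; this loop appends the remaining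
   ones, still found from address 32 on. *)
apply: (@tr_while _ _ _ _ _ _ (fun m N' R' => [/\ m <= n - 30, R' = R,
   N' 15 = m, (forall r, r < 32 -> r \notin [:: 14; 15; 20] -> N' r = N4 r) &
   (forall x, 32 <= x < c -> N' x = N x) /\
   forall k, (k < 30) || (30 + m <= k) -> k < n -> N' (c + 1 + k) = N k.+2]) (n - 30)) => //.
- lia.
- split=> //; split.
    by move=> x hx; rewrite ag4 ?hN3 ?inE; [dif | lia | lia].
  move=> k hk kn; rewrite ag4 ?inE; last lia.
  by rewrite hN3; [dif; congr N; lia | lia].
- by move=> m N' R' [_ _ ->].
- move=> m N5 R5 hm [_ -> h15 hr [hx hk]]; exec.
  rewrite h15 (hr 1) // (hr 16) // (hr 17) // h41 h416 h417 subn1 /= hx; last lia.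
  split=> //; [lia | by rd; dif | |].
  + by move=> r r32; rewrite !inE => hr'; rd; dif; apply: hr; rewrite ?inE //; lia.
  + split; first by move=> x hx'; rd; dif; apply: hx.
    move=> k hk' kn; rd; case: eqP => [e1|ne]; first by congr N; lia.
    by dif; apply: hk; lia.
- move=> N5 R5 [_ -> _ hr [_ hk]]; apply: hQ; rewrite ?hr ?h418 //; first lia.
  by move=> k kn; apply: hk; lia.
Qed.

Lemma sumup_ok M N R n (s : nat -> nat) Q : n <= M -> N 1 = 1 -> N 2 = n -> 32 < N 18 ->
  (forall k, k < n -> N (N 18 + k) = s k) ->
  (forall N', agree [:: 3; 14; 15; 16] N N' -> N' 3 = \sum_(k < n) s k -> Q N' R) ->
  tr M sumup N R Q.
Proof.
move=> nM n1 n2 n18 hs hQ; apply: tr_seq; exec; rewrite n2 addn0.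
apply: (@tr_while _ _ _ _ _ _ (fun m N' R' => [/\ m <= n, R' = R, N' 15 = m,
   agree [:: 3; 14; 15; 16] N N' & N' 3 = \sum_(m <= k < n) s k]) n) => //.
- split=> //; first by agr0.
  by rewrite big_geq.
- by move=> m N' R' [_ _ ->].
- move=> m N1 R1 hm [_ -> h15 ag h3]; have h18 : N1 18 = N 18 by rewrite ag.
  exec.
  rewrite h15 (ag 1) // h18 n1 subn1 /= (ag (N 18 + m)) ?hs // ?inE; last lia.
  split=> //; first lia.
  + by agr ag.
  + by rd; rewrite h3 [RHS]big_ltn // addnC.
- by move=> N' R' [_ -> _ ag h3]; apply: hQ; rewrite // h3 big_mkord.
Qed.
End Relocation.

(** * The complete decoder and its correctness *)

(** For empty [T] the initial [N[0] = 0] already encodes bottom. If [N <= e] no polynomial can be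
    close enough, so bottom is returned without interpolating. *)
Definition decoder : cmd :=
  IfNZ 0 (Seq relocate (Seq sumup (Seq (Blk [:: NSub 16 3 4; NConst 0 0])
    (IfNZ 16 (Seq copyin (Seq fill (Seq kloop finish))) (Blk [::]))))) (Blk [::]).

Section Correctness.
Context (F : fieldType).
Implicit Types (T : seq F) (s : F -> nat) (h : F -> {poly F}) (P : {poly F}).

(** The radius condition cleared of its denominator and of the subtraction [N - e]. *)
Definition close T e s h P :=
  2 * Delta_mult T s h (Enc s P) + e < \sum_(a <- T) s a.

Lemma decoder_ok T e s h (c := init T e s h) M : uniq T ->
  5 * (\sum_(a <- T) s a + size T + 2) <= M ->
  tr M decoder (nreg c) (freg c) (fun N' R' =>
    (N' 0 = 0 /\ forall P, size P <= e.+1 -> ~ close T e s h P) \/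
    (N' 0 != 0 /\ exists P, [/\ size P <= e.+1, close T e s h P,
       forall i, i <= e -> R' i = (P`_i)%R &
       forall S : {poly F}, size S <= e.+1 -> close T e s h S -> S = P])).
Proof.
move=> uT; set n := \sum_(a <- T) s a => hM; rewrite /close -/n.
set Q := (X in tr _ _ _ _ X).
have no_sol : n <= e -> forall P : {poly F}, size P <= e.+1 -> ~ (2 * Delta_mult T s h (Enc s P) + e < n).
  by move=> ne P _; lia.
have e0 : nreg c 0 = size T by [].
apply: tr_ifnz; rewrite e0; case: (posnP (size T)) => [T0|Tpos].
  apply: tr_nil; left; split=> //; apply: no_sol.
  by rewrite /n (size0nil T0) big_nil.
set N0 := nreg c; set R0 := freg c.
apply: tr_seq; apply: (@relocate_ok _ _ _ _ (size T) e) => //; first lia.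
move=> N1 h11 h12 h14 h118 hS.
have {}hS k : k < size T -> N1 (N1 18 + k) = s (nth 0%R T k).
  by move=> hk; rewrite hS // /N0 /c /= (nth_map 0%R).
apply: tr_seq; apply: (@sumup_ok _ _ _ _ (size T) (fun k => s (nth 0%R T k))) => //.
  by move: hM; lia.
move=> N2 ag2 h23.
have {}h23 : N2 3 = n by rewrite h23 /n (big_nth 0%R) big_mkord.
have [h21 h22 h24 h218] : [/\ N2 1 = 1, N2 2 = size T, N2 4 = e & N2 18 = N1 18].
  by rewrite !ag2.
apply: tr_seq; exec; rewrite h23 h24; apply: tr_ifnz; rd.
set N3 := upd _ _ _.
case: ifP => hne; last first.
  by apply: tr_nil; left; split=> //; apply: no_sol; lia.
have en : e < n by lia.
have ag3 : agree [:: 0; 16] N2 N3 by rewrite /N3; agr0.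
have R0z k : size T + n <= k -> R0 k = 0%R.
  move=> hk; rewrite /R0 /c /= nth_default // size_cat.
  suff -> : size (flatten [seq [seq ((h a)`_i)%R | i <- iota 0 (s a)] | a <- T]) = n by [].
  rewrite size_flatten /shape -map_comp /n sumnE big_map.
  by apply: eq_bigr => a _ /=; rewrite size_map size_iota.
apply: tr_seq; apply: (@copyin_ok _ _ _ _ (size T) n) => //; try by rewrite ag3.
  by move: hM; lia.
move=> N4 R4 ag4 k17 k11 k19 k5 k6 k9 k10 hR4.
have [k1 k2 k3 k4] : [/\ N4 1 = 1, N4 2 = size T, N4 3 = n & N4 4 = e].
  by rewrite !ag4 // !ag3.
have k18 : N4 18 = N1 18 by rewrite ag4 // ag3.
set X := N4 5 in k5 k6; set Y := N4 6 in k6 k9; set C3 := N4 9 in k9 k10.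
set C4 := N4 10 in k10.
have hS4 k : k < size T -> N4 (N1 18 + k) = s (nth 0%R T k).
  by move=> hk; rewrite ag4 ?ag3 ?ag2 ?hS // !inE; lia.
apply: tr_seq.
apply: (@fill_ok _ _ _ _ T s h n (5 * n) (size T + n + 9) X Y C3 C4 (N1 18)) => //;
  try by [lia | move: hM; lia].
move=> N5 R5 ag5 m7 m8 m12 m13 repX repY tab.
have [m1 m3 m4 m5] : [/\ N5 1 = 1, N5 3 = n, N5 4 = e & N5 5 = X] by rewrite !ag5.
have [m6 m9 m10 m11] : [/\ N5 6 = Y, N5 9 = C3, N5 10 = C4 & N5 11 = 5 * n].
  by rewrite !ag5.
have m17 : N5 17 = n + n by rewrite ag5.
set bl := blocks T s h (n + n) in repX repY tab.
have szb : 5 * n = size (entries bl) by rewrite size_blocks -/n; lia.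
apply: tr_seq; apply: (@kloop_ok _ _ bl e n (5 * n) X Y C3 C4) => //;
  try by [lia | move: hM; lia | rewrite m7 k4].
move=> N6 R6 d1 w2 E1 W1 E2 W2 ag6 p7 dw gd rep6 sol1 sol2.
have key1 : key_eq T s h E1 W1 by apply: key_eq_val (n + n) _ _ _.
have key2 : key_eq T s h E2 W2 by apply: key_eq_val (n + n) _ _ _.
have E10 : E1 != 0%R by apply: contraNneq (good_lead1 gd) => ->; rewrite coef0.
(* Since [d1 <= n] and [e < n], the degrees of [E1] and [W1] are below [2n], so the truncated blocks
   hold them entirely. *)
apply: (@finish_ok _ _ _ _ e d1 n (n + n) X (X + n) (X + n + (n + n)) Y E1 W1) => //;
  try by [lia | move: hM; lia | rewrite ag6].
- move=> k hk; rewrite -(addnA X n k) rep6; last lia.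
  by rewrite nth_blocksE // valE.
- move=> k hk; rewrite -(addnA X) -(addnA X) rep6; last lia.
  by rewrite nth_blocksW // valW.
- exact: good_lead1 gd.
- exact: good_E1 gd.
- exact: good_W1 gd.
- move=> N' R' h0 hno; left; split=> // P sP hP.
  have [hd eW] := decode_complete uT gd dw key1 key2 sP hP.
  exact: hno hd P sP eW.
- move=> N' R' P h0 hd sP eW hR; right; split=> //; exists P; split=> //.
    by apply: (decode_sound uT gd _ _ eW hd).
  move=> S sS hS'; have [_ eW'] := decode_complete uT gd dw key1 key2 sS hS'.
  by apply: (mulfI E10); rewrite -eW -eW'.
Qed.
End Correctness.

Local Open Scope ring_scope.

Theorem theorem4p3 :
  exists (P : seq instr) (c : nat),
  forall (F : fieldType) (T : seq F) (e : nat) (s : F -> nat) (h : F -> {poly F}),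
    uniq T ->
    (forall a, a \in T -> (size (h a) <= s a)%N) ->
    let N := (\sum_(a <- T) s a)%N in
    exists k : nat,
      (k <= (N + size T + 2) ^ c)%N /\
      halted P (run P k (init T e s h)) /\
      let out := output e (run P k (init T e s h)) in
      (forall R : {poly F}, (size R <= e.+1)%N ->
         (2 * Delta_mult T s h (Enc s R) + e < N)%N -> out = Some R) /\
      ((forall R : {poly F}, (size R <= e.+1)%N ->
         ~ (2 * Delta_mult T s h (Enc s R) + e < N)%N) -> out = None).
Proof.
have [d hd] := cost_poly decoder.
(* Loops make at most [5m] iterations, and [5m <= 2^3 m <= m^4] as [m >= 2]; hence the exponent
   [4 * d]. *)
exists (compile 0 decoder), (4 * d)%N => F T e s h uT _ n.
set m := (n + size T + 2)%N; set P := compile 0 decoder.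
have [|k [N' [R' [hk hr hQ]]]] := decoder_ok e h uT (leqnn (5 * m)) (P := P) (o := 0).
  by move=> i _; rewrite add0n.
exists k; split.
  apply: leq_trans hk _; apply: leq_trans (hd _ _) _; first by rewrite /m; lia.
  rewrite expnM; have [->|d0] := posnP d; first by rewrite !expn0.
  rewrite leq_exp2r //; apply: (@leq_trans (2 ^ 3 * m)); first by rewrite leq_mul2r orbT.
  by rewrite (expnS m 3) mulnC leq_mul2l leq_exp2r ?orbT // /m addn2.
split.
  (* The counter ends just past the code, where [fetch] defaults to [Halt]. *)
  by rewrite hr /halted /fetch nth_default // size_compile add0n.
rewrite hr /output /=; split=> [S sS hS|hno].
  case: hQ => [[_ /(_ S sS hS)]//|[/negPf -> [Q [sQ _ hR' uQ]]]].
  rewrite (uQ S sS hS); congr Some; apply/polyP => i; rewrite coef_poly.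
  case: ltnP => hi; first by rewrite hR'.
  by rewrite nth_default //; apply: leq_trans sQ hi.
case: hQ => [[-> _]//|[_ [Q [sQ cQ _ _]]]].
by have := hno Q sQ cQ.
Qed.
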